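(* Let $0<q<1<p<\infty$. Let $\sigma$ and $\omega$ be locally finite Borel measures on $\mathbb{R}^d$, let $\lambda=\{\lambda_Q\}$ be a family of non-negative reals indexed by dyadic cubes, and let $\mathcal{Q}$ and $T_\lambda(\cdot\,\sigma)$ be the associated collection of cubes and the associated operator. Then the following assertions hold. (i) (Sufficiency) Every family $\{a_Q\}_{Q\in\mathcal{Q}}$ of positive reals satisfies the estimate $$\|T_\lambda(\cdot\,\sigma)\|_{L^p(\sigma)\to L^q(\omega)}\le C_{p,q}\Big(\sup_{Q\in\mathcal{Q}}\frac{1}{\sigma(Q)}\sum_{\substack{R\in\mathcal{Q}\\ R\subseteq Q}}a_R^{-1}\sigma(R)\Big)^{\frac1p}\Big(\int\Big(\sum_{Q\in\mathcal{Q}}\lambda_Q^{p'}\Big(\frac{\omega(Q)}{\sigma(Q)}\Big)^{p'-1}a_Q^{p'-1}1_Q\Big)^{\frac{(p-1)q}{p-q}}\,\mathrm{d}\omega\Big)^{\frac{p-q}{pq}},$$ where the constant $C_{p,q}$ depends only on $p$ and $q$. (ii) (Necessity) There exists a family $\{a_Q\}_{Q\in\mathcal{Q}}$ of positive reals that satisfies the reverse estimate, i.e. $$\Big(\sup_{Q\in\mathcal{Q}}\frac{1}{\sigma(Q)}\sum_{\substack{R\in\mathcal{Q}\\ R\subseteq Q}}a_R^{-1}\sigma(R)\Big)^{\frac1p}\Big(\int\Big(\sum_{Q\in\mathcal{Q}}\lambda_Q^{p'}\Big(\frac{\omega(Q)}{\sigma(Q)}\Big)^{p'-1}a_Q^{p'-1}1_Q\Big)^{\frac{(p-1)q}{p-q}}\,\mathrm{d}\omega\Big)^{\frac{p-q}{pq}}\le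 C'_{p,q}\,\|T_\lambda(\cdot\,\sigma)\|_{L^p(\sigma)\to L^q(\omega)},$$ where the constant $C'_{p,q}$ depends only on $p$ and $q$.
   Context: $\mathcal{D}$ is the collection of all dyadic cubes $2^k([0,1)^d+j)$, $k\in\mathbb{Z}$, $j\in\mathbb{Z}^d$, in $\mathbb{R}^d$. Given non-negative reals $\{\lambda_Q\}_{Q\in\mathcal{D}}$ and measures $\sigma,\omega$, set $\mathcal{Q}:=\{Q\in\mathcal{D}:\lambda_Q>0,\ \sigma(Q)>0,\ \omega(Q)>0\}$. The positive dyadic operator is $T_\lambda(f\sigma):=\sum_{Q\in\mathcal{Q}}\lambda_Q\big(\frac{1}{\sigma(Q)}\int_Q f\,\mathrm{d}\sigma\big)1_Q$. (Restricting the sum from $\mathcal{D}$ to $\mathcal{Q}$ does not affect the norm inequality below.) The norm $\|T_\lambda(\cdot\,\sigma)\|_{L^p(\sigma)\to L^q(\omega)}\in[0,\infty]$ is the least constant $C$ such that $\|T_\lambda(f\sigma)\|_{L^q(\omega)}\le C\|f\|_{L^p(\sigma)}$ for every $f\in L^p(\sigma)$; since $\lambda_Q\ge0$, this amounts to the inequality for non-negative $f$, for which $T_\lambda(f\sigma)$ is well defined with values in $[0,\infty]$. Here $\|g\|_{L^q(\omega)}:=(\int|g|^q\,\mathrm{d}\omega)^{1/q}$ also for $q<1$. $p'=\frac{p}{p-1}$ is the Hölder conjugate. Quantities may take the value $\infty$. *)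

(* Defs.v *)
From mathcomp Require Export all_boot all_order all_algebra.
From mathcomp Require Export all_classical all_reals all_analysis.
Export Order.TTheory GRing.Theory Num.Theory.
Export numFieldNormedType.Exports.

Set Implicit Arguments.
Unset Strict Implicit.
Unset Printing Implicit Defensive.

Local Open Scope classical_set_scope.
Local Open Scope ring_scope.
Local Open Scope ereal_scope.

(* 'rV[R]_d equipped with its Borel sigma-algebra; the underlying type is
   convertible to 'rV[R]_d. *)
Notation borel_space R d := (g_sigma_algebraType (@open 'rV[R]_d)).

Definition locally_finite (R : realType) (d : nat)
    (mu : {measure set (borel_space R d) -> \bar R}) :=
  forall x : 'rV[R]_d, exists2 U : set 'rV[R]_d, open_nbhs x U & mu U < +oo.

Definition dyadic_cube (R : realType) (d : nat) (k : int) (j : 'I_d -> int) :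
    set 'rV[R]_d :=
  [set (2 ^ k *: (y + \row_i (j i)%:~R))%R |
    y in [set y : 'rV[R]_d | forall i, (0 <= y ord0 i < 1)%R]].

Definition dyadic (R : realType) (d : nat) : set (set 'rV[R]_d) :=
  [set Q | exists k j, Q = @dyadic_cube R d k j].

Section dyadic_operator.
Context {R : realType} {d : nat}.
Context (lambda : set 'rV[R]_d -> R).
Context (sigma omega : {measure set (borel_space R d) -> \bar R}).
Implicit Types (p q : R) (a : set 'rV[R]_d -> R).

Definition charged_cubes : set (set 'rV[R]_d) :=
  [set Q | [/\ @dyadic R d Q, (0 < lambda Q)%R, 0 < sigma Q & 0 < omega Q]].

(* T_lambda (f sigma), meaningful for nonnegative f. *)
Definition dyadic_op (f : borel_space R d -> R) (x : borel_space R d) :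
    \bar R :=
  \esum_(Q in charged_cubes)
    ((lambda Q)%:E * ((sigma Q)^-1 * \int[sigma]_(y in Q) (f y)%:E)
     * (\1_Q x)%:E).

Definition dyadic_op_norm p q : \bar R :=
  ereal_inf [set C | 0 <= C /\
    forall f : borel_space R d -> R,
      f \in Lfun sigma p%:E -> (forall x, 0 <= f x)%R ->
      'N[omega]_q%:E[dyadic_op f] <= C * 'N[sigma]_p%:E[EFin \o f]].

(* The supremum is taken in [0, +oo], so that it is 0 (and not -oo) when
   there are no cubes. *)
Definition carleson_const a : \bar R :=
  ereal_sup (0 |` [set (sigma Q)^-1 *
      \esum_(S in charged_cubes `&` [set S | S `<=` Q])
        (((a S)^-1)%:E * sigma S) | Q in charged_cubes]).

Definition conj_exp p : R := (p / (p - 1))%R.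

Definition coef_integral p q a : \bar R :=
  \int[omega]_x
    (\esum_(Q in charged_cubes)
       ((lambda Q `^ conj_exp p)%:E
        * (omega Q / sigma Q) `^ (conj_exp p - 1)
        * (a Q `^ (conj_exp p - 1))%:E
        * (\1_Q x)%:E)) `^ ((p - 1) * q / (p - q)).

Definition coef_bound p q a : \bar R :=
  carleson_const a `^ p^-1 * coef_integral p q a `^ ((p - q) / (p * q)).

End dyadic_operator.

(* Main.v *)
Require Import Defs.
From mathcomp Require Import ring lra measurable_realfun.

(** Sufficiency is two applications of Hoelder's inequality followed by the
    Carleson embedding theorem.  In the sum over the cubes, the product of
    lambda_Q and the average <f>_Q is split into
    lambda_Q (omega(Q) a_Q / sigma(Q))^(1/p) times
    <f>_Q (sigma(Q) / (omega(Q) a_Q))^(1/p); then Hoelder in L^(p/q)(omega)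
    separates the two factors.  The first gives the integral of the theorem,
    the second gives the sum of <f>_Q^p a_Q^-1 sigma(Q), which the packing
    condition bounds by the p-th power of the norm of f.

    For necessity, suppose that T has norm 1.  As q < 1, the integral of
    (Tf)^q d omega is a concave functional of f.  At a maximizer over the unit
    ball of L^p(sigma), with v := Tf, the vanishing of the first variation says
    that T is bounded into L^1(v^(q-1) omega): this is Maurey's factorization.
    By duality the function g, the sum of mu_Q 1_Q with mu_Q the number
    lambda_Q sigma(Q)^-1 int_Q v^(q-1) d omega, is in L^(p')(sigma).  The family
    of the theorem is a_Q := U_Q / mu_Q, where U_Q is the largest average of g
    over the cubes that contain Q.  The packing condition holds because U_R is
    at least <g>_Q when R lies in Q.  In the integral condition a_Q cancels mu_Q
    and leaves lambda_Q (omega(Q) / int_Q v^(q-1) d omega)^(p'-1) U_Q^(p'-1);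
    the ratio is controlled by the maximal function of v^(q/2) with respect to
    omega.  With h the maximal function of g with respect to sigma, U_Q^(p'-1) is
    at most the sigma-average over Q of f := h^(p'-1), so that the sum over Q is
    at most a power of the maximal function of v^(q/2) times Tf.  Hoelder, the two
    maximal inequalities and the bound of T at f conclude.

    All this is carried out for finitely many cubes.  They generate a finite
    algebra of sets, on whose atoms every function that matters is constant, so
    that the estimates become inequalities between finite sums of reals, and a
    near-maximizer can take the place of the maximizer in Maurey's argument.
    The one geometric property of the cubes that enters the estimates is that two
    of them are nested or disjoint, hence no constant depends on the dimension.  Sufficiency passes to all cubes
    by monotone convergence.  In the necessity part the family a depends on the
    finite set of cubes, but each a_Q stays in a compact subset of the positive
    half-line: packing gives a_Q >= 1, and the integral condition bounds a_Q
    from above.  An ultrafilter limit, used up to a factor 2, gives one family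
    for all cubes. *)

Set Implicit Arguments.
Unset Strict Implicit.
Unset Printing Implicit Defensive.
Local Open Scope ring_scope.

(** * Convexity of powers and Hoelder's inequality *)

(** The one convexity inequality from which Young's and Hoelder's inequalities
    below are derived. *)
Lemma weighted_am_gm (R : realType) (al x y : R) :
  0 < al -> al < 1 -> 0 <= x -> 0 <= y ->
  x `^ al * y `^ (1 - al) <= al * x + (1 - al) * y.
Proof.
move=> al0 al1 x0 y0; have be0 : 0 < 1 - al by lra.
have := @conjugate_powR R (x `^ al) (y `^ (1 - al)) al^-1 (1 - al)^-1
  (powR_ge0 _ _) (powR_ge0 _ _).
rewrite !invr_gt0 !invrK -!powRrM !mulfV ?gt_eqF// !powRr1//.
rewrite (mulrC al) (mulrC (1 - al)); apply=> //; lra.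
Qed.

(** The graph of a `^ p lies above its tangent at b. *)
Lemma young_powR (R : realType) (p a b : R) : 1 < p -> 0 <= a -> 0 <= b ->
  p * (b `^ (p - 1) * a) <= a `^ p + (p - 1) * b `^ p.
Proof.
move=> p1 a0 b0; have p0 : 0 < p by lra.
have pV1 : p^-1 < 1 by rewrite invf_lt1.
have pV0 : 0 < p^-1 by rewrite invr_gt0.
have := weighted_am_gm pV0 pV1 (powR_ge0 a p) (powR_ge0 b p).
rewrite -!powRrM mulfV ?gt_eqF// powRr1//.
have -> : p * (1 - p^-1) = p - 1 by field; rewrite gt_eqF.
move=> /(ler_wpM2l (ltW p0)).
rewrite (mulrC (b `^ _)) => /le_trans; apply.
rewrite le_eqVlt; apply/orP; left; apply/eqP; field; rewrite gt_eqF//.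
Qed.

Lemma invr_powR (R : realType) (x r : R) : 0 <= x -> (x^-1) `^ r = (x `^ r)^-1.
Proof. by move=> x0; rewrite -powR_inv1// -powRrM mulN1r powRN. Qed.

(** Hoelder's inequality in the form that fits exponents summing to 1: the weights are
    separate from x and y, so that one statement serves sums over atoms and sums over cubes. *)
Lemma hoelder_sum (R : realType) (I : finType) (P : pred I) (al : R)
    (w x y : I -> R) : 0 < al -> al < 1 ->
  (forall i, P i -> 0 <= w i) -> (forall i, P i -> 0 <= x i) ->
  (forall i, P i -> 0 <= y i) ->
  \sum_(i | P i) w i * (x i `^ al * y i `^ (1 - al)) <=
  (\sum_(i | P i) w i * x i) `^ al * (\sum_(i | P i) w i * y i) `^ (1 - al).
Proof.
move=> al0 al1 w0 x0 y0; have be0 : 0 < 1 - al by lra.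
set X := \sum_(i | P i) w i * x i; set Y := \sum_(i | P i) w i * y i.
have wx0 i : P i -> 0 <= w i * x i by move=> Pi; rewrite mulr_ge0 ?w0 ?x0.
have wy0 i : P i -> 0 <= w i * y i by move=> Pi; rewrite mulr_ge0 ?w0 ?y0.
have X0 : 0 <= X by exact: sumr_ge0.
have Y0 : 0 <= Y by exact: sumr_ge0.
have [XYP|XYN] := boolP ((0 < X) && (0 < Y)); last first.
  rewrite big1 ?mulr_ge0 ?powR_ge0// => i Pi.
  have [w_eq0|wN0] := eqVneq (w i) 0; first by rewrite w_eq0 mul0r.
  have {}XYN : X = 0 \/ Y = 0.
    by move: XYN; rewrite negb_and -!leNgt => /orP[h|h]; [left|right];
      apply/eqP; rewrite eq_le h.
  case: XYN => E.
    have /eqP := psumr_eq0P wx0 E Pi.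
    by rewrite mulf_eq0 (negbTE wN0)/= => /eqP ->; rewrite powR0 ?gt_eqF// mul0r mulr0.
  have /eqP := psumr_eq0P wy0 E Pi.
  by rewrite mulf_eq0 (negbTE wN0)/= => /eqP ->; rewrite [0 `^ _]powR0 ?gt_eqF// !mulr0.
case/andP: XYP => XP YP.
have cX : 0 < X `^ al by exact: powR_gt0.
have cY : 0 < Y `^ (1 - al) by exact: powR_gt0.
rewrite -[leRHS]mulr1 -ler_pdivrMl ?mulr_gt0// mulr_sumr.
apply: (@le_trans _ _ (\sum_(i | P i) (al / X * (w i * x i) + (1 - al) / Y * (w i * y i)))).
  apply: ler_sum => i Pi.
  have := weighted_am_gm al0 al1 (divr_ge0 (x0 _ Pi) X0) (divr_ge0 (y0 _ Pi) Y0).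
  move=> /(ler_wpM2l (w0 _ Pi)).
  rewrite !powRM ?invr_ge0 ?x0 ?y0// !invr_powR//.
  move=> h; apply: (le_trans _ (le_trans h _)).
    by rewrite le_eqVlt; apply/orP; left; apply/eqP; field; rewrite ?gt_eqF.
  by rewrite le_eqVlt; apply/orP; left; apply/eqP; field; rewrite ?gt_eqF.
rewrite big_split/= -!mulr_sumr !divfK ?gt_eqF//; lra.
Qed.

Lemma powR_convex_comb (R : realType) (p a b t : R) : 1 < p -> 0 <= a -> 0 <= b ->
  0 <= t <= 1 -> ((1 - t) * a + t * b) `^ p <= (1 - t) * a `^ p + t * b `^ p.
Proof.
move=> p1 a0 b0 /andP[t0 t1].
have i0 (x : R) : 0 <= x -> x \in (`[0%R, +oo[%classic : set R)%classic.
  by move=> x0; rewrite inE/= in_itv/= x0.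
have := @convex_powR R p (ltW p1) (Itv01 t0 t1) b a (i0 b b0) (i0 a a0).
rewrite [X in _ <= X]convRE => h.
have -> : (1 - t) * a + t * b = t * b + (1 - t) * a by ring.
apply: le_trans h _ => /=.
by rewrite addrC.
Qed.

(** * The Carleson embedding theorem on a finite model *)

Section finite_model.
Context {R : realType} {I K : finType}.
Variable D : K -> {set I}.
Implicit Types (m f rho : I -> R) (k l : K).

Definition mass m k : R := \sum_(i in D k) m i.

(** In a list sorted from small to large cubes, an earlier cube lies in a later one or
    misses it. *)
Definition nested : rel K := [rel l k | (D l \subset D k) || [disjoint D l & D k]].

(** As k contains l or misses it, a sum over k sees all of a change made inside l, or
    nothing of it. *)
Lemma mass_change m m' e k l : nested l k ->
  (forall i, i \notin D l -> m' i = m i) -> mass m' l = mass m l + e ->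
  mass m' k = mass m k + (if D l \subset D k then e else 0).
Proof.
rewrite /nested/= /mass => nlk off eqe; case: ifPn nlk => [sub _|_ /= dis].
  rewrite (big_setID (D l))/= [in RHS](big_setID (D l))/= (finset.setIidPr sub) eqe.
  rewrite (eq_bigr m) => [|i]; first by rewrite addrAC.
  by rewrite inE => /andP[/off ->].
rewrite addr0; apply: eq_bigr => i ik; apply: off.
by rewrite (disjointFl dis ik).
Qed.

(** The packing condition is spent one cube at a time, from the smallest to the largest.
    Every point carries a mass m and a value rho, and sum m rho^p is the budget.  At the cube
    of head k0, of mass M and first moment X, the mass of the cube is increased to M + c k0
    and the values on it are replaced by t := X / (M + c k0), which keeps the first moment
    of every later cube.  The tangent at t to the p-th power shows that the budget drops by
    at least (p - 1) (c k0) t^p, which pays the term of k0.  The total mass of a cube when its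
    turn comes is bounded by Y. *)
Lemma carleson_seq (p : R) (c Y : K -> R) (ks : seq K) m rho : 1 < p ->
  (forall k, 0 <= c k) ->
  pairwise nested ks ->
  (forall i, 0 <= m i) -> (forall i, 0 <= rho i) ->
  (forall k, k \in ks -> 0 < mass m k) ->
  (forall k, k \in ks ->
    mass m k + \sum_(l <- ks | D l \subset D k) c l <= Y k) ->
  (p - 1) * \sum_(k <- ks) c k * (mass (fun i => m i * rho i) k / Y k) `^ p
    <= \sum_i m i * rho i `^ p.
Proof.
move=> p1 c0; elim: ks m rho => [|k0 ks IH] m rho.
  by move=> _ m0 r0 _ _; rewrite big_nil mulr0 sumr_ge0// => i _; rewrite mulr_ge0 ?powR_ge0.
move=> /= /andP[k0ks pks] m0 rho0 massP YP.
set X := mass (fun i => m i * rho i) k0; set M := mass m k0.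
have M0 : 0 < M by apply: massP; rewrite mem_head.
have MN0 : M != 0 by rewrite gt_eqF.
have X0 : 0 <= X by apply: sumr_ge0 => i _; rewrite mulr_ge0.
have Mc0 : 0 < M + c k0 by rewrite ltr_pwDl.
set t := X / (M + c k0).
have t0 : 0 <= t by rewrite divr_ge0// ltW.
have tX : t * (M + c k0) = X by rewrite divfK// gt_eqF.
have YX : X / Y k0 <= t.
  have := YP k0 (mem_head _ _); rewrite big_cons subxx -/M => h.
  have {}h : M + c k0 <= Y k0.
    apply: le_trans h; rewrite lerD2l lerDl sumr_ge0//.
  by rewrite ler_wpM2l// lef_pV2// posrE (lt_le_trans Mc0).
(* The added mass is spread over the cube in proportion to m. *)
pose m' i := if i \in D k0 then m i * (1 + c k0 / M) else m i.
pose rho' i := if i \in D k0 then t else rho i.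
have m'0 i : 0 <= m' i.
  by rewrite /m'; case: ifP => // _; rewrite mulr_ge0// addr_ge0// divr_ge0// ltW.
have rho'0 i : 0 <= rho' i by rewrite /rho'; case: ifP.
have massk0 : mass m' k0 = mass m k0 + c k0.
  rewrite /mass (eq_bigr (fun i => m i * (1 + c k0 / M))) => [|i ik]; last by rewrite /m' ik.
  by rewrite -mulr_suml -[\sum_(i in _) _]/M mulrDr mulr1 mulrCA divff// mulr1.
have massE k : k \in ks -> mass m' k = mass m k + (if D k0 \subset D k then c k0 else 0).
  move=> kks; apply: mass_change massk0; first exact: (allP k0ks).
  by move=> i; rewrite /m' => /negbTE ->.
have XE k : k \in ks -> mass (fun i => m' i * rho' i) k = mass (fun i => m i * rho i) k.
  move=> kks; rewrite (@mass_change (fun i => m i * rho i) _ 0 k k0) ?if_same ?addr0//.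
  - exact: (allP k0ks).
  - by move=> i; rewrite /m' /rho' => /negbTE ->.
  rewrite -/X -tX -massk0 mulrC /mass mulr_suml; apply: eq_bigr => i ik.
  by rewrite /rho' ik.
have := IH m' rho' pks m'0 rho'0.
have -> : \sum_(k <- ks) c k * (mass (fun i => m' i * rho' i) k / Y k) `^ p =
  \sum_(k <- ks) c k * (mass (fun i => m i * rho i) k / Y k) `^ p.
  by apply: eq_big_seq => k kks; rewrite XE.
move=> {}IH; rewrite big_cons mulrDr.
have {}IH : (p - 1) * (\sum_(k <- ks) c k * (mass (fun i => m i * rho i) k / Y k) `^ p)
    <= \sum_i m' i * rho' i `^ p.
  apply: IH => k kks.
    by rewrite massE// ltr_wpDr ?massP ?inE ?kks ?orbT//; case: ifP.
  have := YP k; rewrite inE kks orbT big_cons => /(_ isT); rewrite massE//.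
  by case: ifP => _; rewrite ?addrA ?addr0.
apply: (le_trans (lerD (lexx _) IH)).
rewrite (bigID (mem (D k0)))/= [leRHS](bigID (mem (D k0)))/= addrA lerD//; last first.
  by rewrite ler_sum// => i /negbTE; rewrite /m' /rho' => ->.
have -> : \sum_(i in D k0) m' i * rho' i `^ p = (M + c k0) * t `^ p.
  rewrite -massk0 mulr_suml; apply: eq_bigr => i ik; by rewrite /rho' ik.
apply: (@le_trans _ _ (\sum_(i in D k0)
    m i * (p * (t `^ (p - 1) * rho i) - (p - 1) * t `^ p))); last first.
  apply: ler_sum => i ik; apply: ler_wpM2l => //; rewrite lerBlDr.
  exact: young_powR.
have -> : \sum_(i in D k0) m i * (p * (t `^ (p - 1) * rho i) - (p - 1) * t `^ p) =
  p * t `^ (p - 1) * X - (p - 1) * t `^ p * M.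
  rewrite /X /M /mass !mulr_sumr -sumrB; apply: eq_bigr => i _; ring.
have tp : t `^ (p - 1) * X = t `^ p * (M + c k0).
  by rewrite -tX mulrA (mulrC _ t) mulr_powRB1//; lra.
rewrite -mulrA tp.
have : (X / Y k0) `^ p <= t `^ p.
  apply: ge0_ler_powR; rewrite ?nnegrE//; first by lra.
  rewrite divr_ge0//; apply: le_trans (YP k0 (mem_head _ _)).
  by apply: addr_ge0; [exact: ltW | exact: sumr_ge0].
move=> /(ler_wpM2l (c0 k0)) /(@ler_wpM2l _ (p - 1)) => /(_ ltac:(lra)) h.
apply: (le_trans (lerD h (lexx _))); rewrite le_eqVlt; apply/orP; left; apply/eqP; ring.
Qed.

Definition laminar :=
  forall k l, [|| D k \subset D l, D l \subset D k | [disjoint D k & D l]].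

Definition avg m k f : R := mass (fun i => m i * f i) k / mass m k.

Definition embedding_cst (p : R) : R := 2 `^ p / (p - 1).

Lemma embedding_cst_gt0 p : 1 < p -> 0 < embedding_cst p.
Proof. by move=> p1; rewrite divr_gt0 ?powR_gt0// subr_gt0. Qed.

(** Sorting by cardinality makes every laminar family a valid input of [carleson_seq]. *)
Lemma laminar_pairwise : laminar ->
  pairwise nested (sort (relpre (fun k => #|D k|) leq) (enum K)).
Proof.
move=> lam; set le := relpre _ _.
apply: (@sub_pairwise _ le) => [l k /= lek|].
  rewrite /nested/=; case/or3P: (lam l k) => [->//|kl|->]; last by rewrite orbT.
  suff -> : D l = D k by rewrite subxx.
  by apply/esym/eqP; rewrite eqEcard kl.
rewrite -sorted_pairwise; last by move=> a b d; rewrite /le/=; exact: leq_trans.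
by apply: sort_sorted => a b; exact: leq_total.
Qed.

(** The packing condition bounds the final mass of a cube by twice its mass, whence the
    factor 2 `^ p in the constant. *)
Lemma carleson_embedding (p A : R) (c : K -> R) m f : 1 < p -> 0 < A ->
  laminar -> (forall k, 0 <= c k) ->
  (forall i, 0 <= m i) -> (forall i, 0 <= f i) -> (forall k, 0 < mass m k) ->
  (forall k, \sum_(l | D l \subset D k) c l <= A * mass m k) ->
  \sum_k c k * avg m k f `^ p <= A * embedding_cst p * \sum_i m i * f i `^ p.
Proof.
move=> p1 A0 lam c0 m0 f0 massP cP.
pose ks := sort (relpre (fun k => #|D k|) leq) (enum K).
have ksE (P : pred K) (F : K -> R) : \sum_(k <- ks | P k) F k = \sum_(k | P k) F k.
  by rewrite (perm_big (enum K)) ?perm_sort//= big_enum_cond; apply: eq_bigl.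
have cA0 k : 0 <= c k / A by rewrite divr_ge0// ltW.
have := @carleson_seq p (fun k => c k / A) (fun k => 2 * mass m k) ks m f p1 cA0
  (laminar_pairwise lam) m0 f0 (fun k _ => massP k).
have h k : k \in ks -> mass m k + \sum_(l <- ks | D l \subset D k) c l / A <= 2 * mass m k.
  move=> _; rewrite ksE -mulr_suml mulrC (mulrC 2) mulr_natr mulr2n lerD2l mulrC.
  by rewrite ler_pdivrMr// mulrC.
move=> /(_ h); rewrite ksE.
have -> : \sum_k c k / A * (mass (fun i => m i * f i) k / (2 * mass m k)) `^ p
  = A^-1 * (2 `^ p)^-1 * \sum_k c k * avg m k f `^ p.
  rewrite mulr_sumr; apply: eq_bigr => k _; rewrite invfM mulrCA powRM ?invr_ge0//; last first.
    by apply: divr_ge0; [apply: sumr_ge0 => i _; rewrite mulr_ge0|exact: ltW].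
  rewrite invr_powR// /avg; ring.
have h2 : 0 < 2 `^ p :> R by rewrite powR_gt0.
have p10 : 0 < p - 1 by lra.
rewrite -ler_pdivlMl// -ler_pdivlMl ?mulr_gt0 ?invr_gt0// => /le_trans; apply.
rewrite le_eqVlt; apply/orP; left; apply/eqP; rewrite /embedding_cst; field.
by rewrite !gt_eqF.
Qed.

(** The maximal function enters in linearized form: kap selects, at each point, a cube that
    contains it.  The sets on which kap is constant are disjoint, so that their masses satisfy
    the packing condition with constant 1. *)
Lemma maximal_inequality (p : R) m f (kap : I -> K) : 1 < p -> laminar ->
  (forall i, 0 <= m i) -> (forall i, 0 <= f i) -> (forall k, 0 < mass m k) ->
  (forall i, i \in D (kap i)) ->
  \sum_i m i * avg m (kap i) f `^ p <= embedding_cst p * \sum_i m i * f i `^ p.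
Proof.
move=> p1 lam m0 f0 massP kapP.
pose c k := \sum_(i | kap i == k) m i.
rewrite -[embedding_cst p]mul1r.
have -> : \sum_i m i * avg m (kap i) f `^ p = \sum_k c k * avg m k f `^ p.
  rewrite (partition_big kap xpredT)//=; apply: eq_bigr => k _.
  by rewrite mulr_suml; apply: eq_bigr => i /eqP ->.
apply: carleson_embedding => // k; first by rewrite sumr_ge0.
rewrite mul1r.
have -> : \sum_(l | D l \subset D k) c l = \sum_(i | D (kap i) \subset D k) m i.
  rewrite (partition_big kap (fun l => D l \subset D k))//=.
  apply: eq_bigr => l lk; apply: eq_bigl => i.
  by case: eqVneq => [->|_]; rewrite ?lk ?andbF.
rewrite /mass [leRHS](bigID (fun i => D (kap i) \subset D k))/=.
rewrite [X in _ <= X + _](_ : _ = \sum_(i | D (kap i) \subset D k) m i); last first.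
  apply: eq_bigl => i; case: (boolP (D (kap i) \subset D k)) => [h|]; rewrite ?andbF//.
  by rewrite (fintype.subsetP h _ (kapP i)).
by rewrite lerDl sumr_ge0.
Qed.

Lemma argmax_cube (F : K -> R) : (forall i, exists k, i \in D k) ->
  exists kap : I -> K, forall i, i \in D (kap i) /\
    forall k, i \in D k -> F k <= F (kap i).
Proof.
move=> cov.
have sel i : exists k, i \in D k /\ forall l, i \in D l -> F l <= F k.
  have [k0 ik0] := cov i.
  by case: (@arg_maxP _ _ _ k0 (fun k => i \in D k) F ik0) => k ik h; exists k; split.
by have [kap kapP] := boolp.choice sel; exists kap.
Qed.

End finite_model.

(** * Sufficiency on a finite model *)

Lemma conj_expB1 (R : realType) (p : R) : 1 < p -> conj_exp p - 1 = (p - 1)^-1.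
Proof. by move=> p1; rewrite /conj_exp; field; rewrite gt_eqF//; lra. Qed.

Lemma conj_exp_gt1 (R : realType) (p : R) : 1 < p -> 1 < conj_exp p.
Proof. by move=> p1; rewrite -subr_gt0 conj_expB1// invr_gt0 subr_gt0. Qed.

(** The splitting of lambda <f> in the first use of Hoelder's inequality, with
    u = omega(Q) a_Q / sigma(Q). *)
Lemma hoelder_split (R : realType) (p l b u : R) : 1 < p -> 0 <= l -> 0 <= b ->
  0 < u -> l * b =
  (b `^ p * u^-1) `^ p^-1 * (l `^ conj_exp p * u `^ (conj_exp p - 1)) `^ (1 - p^-1).
Proof.
move=> p1 l0 b0 u0; have p0 : 0 < p by lra.
have p10 : 0 < p - 1 by lra.
rewrite !powRM ?powR_ge0 ?invr_ge0 ?(ltW u0)// invr_powR ?(ltW u0)// -!powRrM.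
have -> : conj_exp p * (1 - p^-1) = 1.
  by rewrite /conj_exp; field; rewrite !gt_eqF.
have -> : (conj_exp p - 1) * (1 - p^-1) = p^-1.
  by rewrite conj_expB1//; field; rewrite !gt_eqF.
rewrite mulfV ?gt_eqF// !powRr1//; field.
by rewrite gt_eqF// powR_gt0.
Qed.

Section finite_sufficiency.
Context {R : realType} {I K : finType}.
Variables (D : K -> {set I}) (s w : I -> R) (lam : K -> R).

Definition disc_op (f : I -> R) i : R := \sum_(k | i \in D k) lam k * avg D s k f.

Definition disc_coef (p : R) (a : K -> R) i : R :=
  \sum_(k | i \in D k)
    lam k `^ conj_exp p * (mass D w k / mass D s k) `^ (conj_exp p - 1)
    * a k `^ (conj_exp p - 1).

Hypotheses (s0 : forall i, 0 <= s i) (w0 : forall i, 0 <= w i).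
Hypotheses (sP : forall k, 0 < mass D s k) (wP : forall k, 0 < mass D w k).
Hypothesis lamP : forall k, 0 < lam k.

Lemma avg_ge0 (m f : I -> R) k : (forall i, 0 <= m i) -> (forall i, 0 <= f i) -> 0 <= avg D m k f.
Proof.
by move=> m0 f0; rewrite divr_ge0// sumr_ge0// => i _; rewrite mulr_ge0.
Qed.

Lemma disc_op_ge0 f i : (forall i, 0 <= f i) -> 0 <= disc_op f i.
Proof.
by move=> f0; rewrite sumr_ge0// => k _; rewrite mulr_ge0 ?avg_ge0// ltW.
Qed.

(** Summation over pairs point in cube, in the two orders; it moves the adjoint of the
    operator from one side to the other. *)
Lemma sum_mass (m : I -> R) (F : K -> R) :
  \sum_i m i * \sum_(k | i \in D k) F k = \sum_k mass D m k * F k.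
Proof.
under eq_bigr do rewrite mulr_sumr big_mkcond.
rewrite exchange_big/=; apply: eq_bigr => k _.
by rewrite /mass mulr_suml [RHS]big_mkcond.
Qed.

Lemma finite_sufficiency (p q A : R) (a : K -> R) f : 0 < q -> q < 1 -> 1 < p ->
  laminar D -> 0 < A -> (forall k, 0 < a k) ->
  (forall k, \sum_(l | D l \subset D k) (a l)^-1 * mass D s l <= A * mass D s k) ->
  (forall i, 0 <= f i) ->
  \sum_i w i * disc_op f i `^ q <=
  (A * embedding_cst p * \sum_i s i * f i `^ p) `^ (q / p) *
  (\sum_i w i * disc_coef p a i `^ ((p - 1) * q / (p - q))) `^ ((p - q) / p).
Proof.
move=> q0 q1 p1 lamn A0 a0 carl f0.
have p0 : 0 < p by lra.
have pq0 : 0 < p - q by lra.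
have p10 : 0 < p - 1 by lra.
have pV0 : 0 < p^-1 by rewrite invr_gt0.
have pV1 : p^-1 < 1 by rewrite invf_lt1.
pose u k := mass D w k / mass D s k * a k.
have u0 k : 0 < u k by rewrite mulr_gt0// divr_gt0.
pose X k := avg D s k f `^ p * (u k)^-1.
pose Y k := lam k `^ conj_exp p * (mass D w k / mass D s k) `^ (conj_exp p - 1)
    * a k `^ (conj_exp p - 1).
have X0 k : 0 <= X k by rewrite mulr_ge0 ?powR_ge0 ?invr_ge0 ?ltW.
have Y0 k : 0 <= Y k by rewrite !mulr_ge0 ?powR_ge0.
have XY k : lam k * avg D s k f = 1 * (X k `^ p^-1 * Y k `^ (1 - p^-1)).
  have -> : Y k = lam k `^ conj_exp p * u k `^ (conj_exp p - 1).
    by rewrite /Y /u -mulrA -powRM// ?divr_ge0 ?ltW.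
  by rewrite mul1r; apply: hoelder_split => //; [exact: ltW | exact: avg_ge0].
pose H i := \sum_(k | i \in D k) X k.
have H0 i : 0 <= H i by rewrite sumr_ge0.
have G0 i : 0 <= disc_coef p a i by apply: sumr_ge0 => k _; exact: Y0.
have pt i : disc_op f i <= H i `^ p^-1 * disc_coef p a i `^ (1 - p^-1).
  have := @hoelder_sum R K (fun k => i \in D k) p^-1 (fun=> 1) X Y pV0 pV1
    (fun _ _ => ler01) (fun k _ => X0 k) (fun k _ => Y0 k).
  rewrite (eq_bigr (fun k => lam k * avg D s k f)); last by move=> k _; rewrite XY.
  have mul1E (F : K -> R) : \sum_(k | i \in D k) 1 * F k = \sum_(k | i \in D k) F k.
    by apply: eq_bigr => k _; rewrite mul1r.
  by rewrite !mul1E.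
have qp0 : 0 < q / p by rewrite divr_gt0.
have qp1 : q / p < 1 by rewrite ltr_pdivrMr//; lra.
set th := (p - 1) * q / (p - q).
apply: (@le_trans _ _ (\sum_i w i * (H i `^ (q / p) * (disc_coef p a i `^ th) `^ (1 - q / p)))).
  apply: ler_sum => i _; apply: ler_wpM2l => //.
  rewrite -powRrM (_ : th * _ = (1 - p^-1) * q); last first.
    by rewrite /th; field; rewrite !gt_eqF.
  rewrite (_ : q / p = p^-1 * q); last by rewrite mulrC.
  rewrite !powRrM -powRM ?powR_ge0//.
  apply: ge0_ler_powR => //; rewrite ?nnegrE ?mulr_ge0 ?powR_ge0//; first exact: ltW.
  exact: disc_op_ge0.
apply: (le_trans (hoelder_sum _ _ _ _ _)) => // [i _|]; first exact: powR_ge0.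
rewrite (_ : 1 - q / p = (p - q) / p); last by field; rewrite gt_eqF.
apply: ler_wpM2r; first exact: powR_ge0.
apply: ge0_ler_powR; first exact: ltW.
- by rewrite nnegrE sumr_ge0// => i _; rewrite mulr_ge0.
- rewrite nnegrE; apply: mulr_ge0.
    by apply: mulr_ge0; apply: ltW => //; exact: embedding_cst_gt0.
  by apply: sumr_ge0 => i _; rewrite mulr_ge0 ?powR_ge0.
rewrite sum_mass.
rewrite (eq_bigr (fun k => (a k)^-1 * mass D s k * avg D s k f `^ p)); last first.
  by move=> k _; rewrite /X /u; field; rewrite !gt_eqF.
by apply: carleson_embedding => // k; rewrite mulr_ge0 ?invr_ge0 ?ltW.
Qed.

End finite_sufficiency.

(** * Maurey factorization on a finite model *)

(** The concave counterpart of [young_powR]. *)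
Lemma powR_le_tangent (R : realType) (q a b : R) : 0 < q -> q < 1 ->
  0 <= a -> 0 < b -> a `^ q <= b `^ q + q * (b `^ (q - 1) * (a - b)).
Proof.
move=> q0 q1 a0 b0.
have := weighted_am_gm q0 q1 a0 (ltW b0).
move=> /(ler_wpM2l (powR_ge0 b (q - 1))).
rewrite mulrCA -powRD ?(gt_eqF b0) ?implybT// (_ : q - 1 + (1 - q) = 0); last by ring.
rewrite powRr0 mulr1 => /le_trans; apply.
rewrite -[in b `^ q](mulr_powRB1 (ltW b0) q0).
rewrite le_eqVlt; apply/orP; left; apply/eqP; ring.
Qed.

(** A crude form of subadditivity; the factor 2 affects the numerical
    constants of [maurey_finite] and nothing else. *)
Lemma powRD_le (R : realType) (q a b : R) : 0 < q -> q < 1 ->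
  0 <= a -> 0 <= b -> (a + b) `^ q <= 2 * (a `^ q + b `^ q).
Proof.
move=> q0 q1.
wlog ab : a b / a <= b => [hw a0 b0|a0 b0].
  by have [/hw|/ltW/hw] := leP a b; [exact|rewrite addrC (addrC (a `^ _)); exact].
apply: (@le_trans _ _ ((2 * b) `^ q)).
  by apply: ge0_ler_powR; rewrite ?nnegrE; lra.
rewrite powRM// ler_pM ?powR_ge0//; last by rewrite lerDr powR_ge0.
by apply: ler1_powR; lra.
Qed.

(** Maurey's factorization for a convex set U of functions that is bounded in L^q, q < 1.
    With e > 0 small, take u0 in U almost maximizing F u = sum w (u + e)^q and v := u0 + e.
    For u in U, moving from u0 towards u by a small step t raises F by at most t q; by
    concavity this bounds the first variation at the new point, the sum of
    w vt^(q-1) (u - u0), by 1.  As e and the bound B make vt and v comparable, vt can be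
    replaced by v.  The role of e is to keep v away from 0, the role of B to choose t
    uniformly in u; neither enters the constants 4 and 18. *)
Lemma maurey_finite (R : realType) (I : finType) (q B : R) (w : I -> R)
    (U : set (I -> R)) : 0 < q -> q < 1 -> 0 <= B ->
  (forall i, 0 <= w i) -> (exists u, U u) ->
  (forall u i, U u -> 0 <= u i <= B) ->
  (forall u u' t, U u -> U u' -> 0 <= t <= 1 -> U (fun i => (1 - t) * u i + t * u' i)) ->
  (forall u, U u -> \sum_i w i * u i `^ q <= 1) ->
  exists v : I -> R, [/\ forall i, 0 < v i, \sum_i w i * v i `^ q <= 4 &
    forall u, U u -> \sum_i w i * v i `^ (q - 1) * u i <= 18].
Proof.
move=> q0 q1 B0 w0 [u1 Uu1] UB Uconv Uq.
set W := \sum_i w i.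
have W0 : 0 <= W by exact: sumr_ge0.
(* Chosen so that e `^ q * W <= 1. *)
pose e := ((1 + W)^-1) `^ q^-1.
have e0 : 0 < e by rewrite powR_gt0// invr_gt0; lra.
have eW : e `^ q * W <= 1.
  rewrite /e -powRrM mulVf ?gt_eqF// powRr1 ?invr_ge0; last by lra.
  by rewrite ler_pdivrMl; lra.
pose F (u : I -> R) := \sum_i w i * (u i + e) `^ q.
have F4 u : U u -> F u <= 4.
  move=> Uu; apply: (@le_trans _ _ (\sum_i (2 * (w i * u i `^ q) + 2 * (e `^ q * w i)))).
    apply: ler_sum => i _.
    have := powRD_le q0 q1 (proj1 (andP (UB _ i Uu))) (ltW e0).
    move=> /(ler_wpM2l (w0 i)) /le_trans; apply.
    by rewrite le_eqVlt; apply/orP; left; apply/eqP; ring.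
  rewrite big_split/= -!mulr_sumr -/W; have := Uq _ Uu; lra.
pose S := [set F u | u in U]%classic.
have supS : has_sup S.
  split; first by exists (F u1), u1.
  by exists 4 => _ [u Uu <-]; exact: F4.
(* With t <= 1/2 and t * B <= e, the point ut + e lies between v / 2 and 2 v. *)
pose t := Num.min 2^-1 (e / (1 + B)).
have B10 : 0 < 1 + B by lra.
have t0 : 0 < t by rewrite lt_min invr_gt0 ltr0n divr_gt0.
have t12 : t <= 2^-1 by rewrite ge_min lexx.
have tB : t * B <= e.
  have h : t <= e / (1 + B) by rewrite ge_min lexx orbT.
  have : t * (1 + B) <= e by rewrite -ler_pdivlMr.
  by nra.
have tq0 : 0 < t * q by rewrite mulr_gt0.
have [_ [u0 Uu0 <-] u0S] := sup_adherent tq0 supS.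
pose v i := u0 i + e.
have u00 i : 0 <= u0 i by have /andP[] := UB _ i Uu0.
have v0 i : 0 < v i by rewrite /v ltr_wpDl.
exists v; split=> //; first exact: F4.
move=> u Uu.
have uu0 i : 0 <= u i by have /andP[] := UB _ i Uu.
pose ut i := (1 - t) * u0 i + t * u i.
have Uut : U ut by apply: Uconv => //; apply/andP; split; lra.
have Fut : F ut <= F u0 + t * q.
  have : F ut <= sup S by apply: sup_upper_bound => //; exists ut.
  lra.
pose vt i := ut i + e.
have tu i : 0 <= t * u i <= e.
  have /andP[_ uB] := UB _ i Uu; rewrite mulr_ge0 ?(ltW t0)//=.
  by apply: le_trans tB; rewrite ler_wpM2l// ltW.
have vtlo i : v i / 2 <= vt i.
  rewrite /vt /ut /v; have /andP[? _] := tu i; have := u00 i; nra.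
have vthi i : vt i <= 2 * v i.
  rewrite /vt /ut /v; have /andP[_ ?] := tu i; have := u00 i; nra.
have vt0 i : 0 < vt i by apply: lt_le_trans (vtlo i); rewrite divr_gt0.
have key : \sum_i w i * (vt i `^ (q - 1) * (u i - u0 i)) <= 1.
  rewrite -(ler_pM2l tq0) mulr1.
  have : \sum_i w i * v i `^ q <= \sum_i w i * vt i `^ q -
     t * q * (\sum_i w i * (vt i `^ (q - 1) * (u i - u0 i))).
    rewrite mulr_sumr -sumrB; apply: ler_sum => i _.
    have := powR_le_tangent q0 q1 (ltW (v0 i)) (vt0 i).
    move=> /(ler_wpM2l (w0 i)) /le_trans; apply.
    rewrite (_ : v i - vt i = - t * (u i - u0 i)); last by rewrite /v /vt /ut; ring.
    by rewrite le_eqVlt; apply/orP; left; apply/eqP; ring.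
  rewrite -/(F u0) -/(F ut); lra.
have q1' : 1 - q >= 0 by lra.
have powN x : 0 < x -> x `^ (q - 1) = (x `^ (1 - q))^-1.
  by move=> x0; rewrite -powRN opprB.
have two1 : 1 <= (2 : R) `^ (1 - q) by rewrite -[leLHS](powRr0 2); apply: ler_powR; lra.
have two2 : (2 : R) `^ (1 - q) <= 2 by apply: ler1_powR; lra.
have mono a b : 0 < a -> a <= b -> b `^ (q - 1) <= a `^ (q - 1).
  move=> a0 ab; rewrite !powN//; last exact: lt_le_trans ab.
  rewrite lef_pV2 ?posrE ?powR_gt0//; last exact: lt_le_trans ab.
  by apply: ge0_ler_powR => //; rewrite nnegrE; lra.
have vtup i : vt i `^ (q - 1) <= 2 * v i `^ (q - 1).
  apply: (le_trans (mono _ _ _ (vtlo i))); first by rewrite divr_gt0.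
  rewrite powRM ?invr_ge0 ?(ltW (v0 i))// mulrC; apply: ler_wpM2r; first exact: powR_ge0.
  by rewrite powN ?invr_gt0// invr_powR// invrK.
have vtdn i : v i `^ (q - 1) <= 2 * vt i `^ (q - 1).
  have := mono _ _ (vt0 i) (vthi i).
  rewrite powRM ?(ltW (v0 i))// (powN 2)// ler_pdivrMl; last by rewrite powR_gt0.
  by move=> /le_trans; apply; rewrite ler_wpM2r ?powR_ge0.
have e1 : \sum_i w i * v i `^ (q - 1) * u i <= 2 * \sum_i w i * (vt i `^ (q - 1) * u i).
  rewrite mulr_sumr; apply: ler_sum => i _; rewrite -mulrA [leRHS]mulrCA; apply: ler_wpM2l => //.
  by rewrite mulrA; apply: ler_wpM2r.
have e2 : \sum_i w i * (vt i `^ (q - 1) * u0 i) <= 2 * F u0.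
  rewrite mulr_sumr; apply: ler_sum => i _; rewrite [leRHS]mulrCA; apply: ler_wpM2l => //.
  rewrite -/(v i) -(mulr_powRB1 (ltW (v0 i)) q0) [v i * _]mulrC mulrA.
  apply: ler_pM => //; first exact: powR_ge0.
  by rewrite /v lerDl ltW.
have e3 : \sum_i w i * (vt i `^ (q - 1) * (u i - u0 i)) =
  \sum_i w i * (vt i `^ (q - 1) * u i) - \sum_i w i * (vt i `^ (q - 1) * u0 i).
  by rewrite -sumrB; apply: eq_bigr => i _; ring.
have := F4 _ Uu0; lra.
Qed.

Lemma conj_expM (R : realType) (p : R) : 1 < p -> (conj_exp p - 1) * p = conj_exp p.
Proof. by move=> p1; rewrite conj_expB1// /conj_exp mulrC. Qed.

(** The norm of g in L^p' is attained by testing against g^(p'-1), normalized. *)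
Lemma finite_duality (R : realType) (I : finType) (p c : R) (s g : I -> R) :
  1 < p -> 0 <= c -> (forall i, 0 <= s i) -> (forall i, 0 <= g i) ->
  (forall f : I -> R, (forall i, 0 <= f i) -> \sum_i s i * f i `^ p <= 1 ->
    \sum_i s i * f i * g i <= c) ->
  \sum_i s i * g i `^ conj_exp p <= c `^ conj_exp p.
Proof.
move=> p1 c0 s0 g0 dual.
have r1 := conj_exp_gt1 p1; set r := conj_exp p in r1 *.
have p0 : 0 < p by lra.
have r0 : 0 < r by lra.
set S := \sum_i s i * g i `^ r.
have S0 : 0 <= S by apply: sumr_ge0 => i _; rewrite mulr_ge0 ?powR_ge0.
move: S0; rewrite le_eqVlt => /predU1P[<-|S0]; first exact: powR_ge0.
pose f i := g i `^ (r - 1) * (S `^ p^-1)^-1.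
have f0 i : 0 <= f i by rewrite mulr_ge0 ?invr_ge0 ?powR_ge0.
have fp i : f i `^ p = g i `^ r / S.
  rewrite powRM ?invr_ge0 ?powR_ge0// invr_powR ?powR_ge0// -!powRrM.
  by rewrite conj_expM// mulVf ?gt_eqF// powRr1// ltW.
have := dual f f0.
have -> : \sum_i s i * f i `^ p = 1.
  rewrite (eq_bigr (fun i => s i * g i `^ r * S^-1)) => [|i _]; last by rewrite fp mulrA.
  by rewrite -mulr_suml divff// gt_eqF.
move=> /(_ (lexx _)).
have -> : \sum_i s i * f i * g i = S `^ r^-1.
  rewrite (eq_bigr (fun i => s i * g i `^ r * (S `^ p^-1)^-1)) => [|i _]; last first.
    by rewrite -(mulr_powRB1 (g0 i) r0) /f; ring.
  rewrite -mulr_suml -/S -{1}(powRr1 (ltW S0)) -powRN -powRD ?(gt_eqF S0) ?implybT//.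
  by congr (_ `^ _); rewrite /r /conj_exp; field; rewrite !gt_eqF//; lra.
move=> Sc; have : (S `^ r^-1) `^ r <= c `^ r.
  by apply: ge0_ler_powR; rewrite ?nnegrE ?powR_ge0// ltW.
by rewrite -powRrM mulVf ?gt_eqF// powRr1// ltW.
Qed.

Definition necessity_cst (R : realType) (p q : R) : R :=
  (embedding_cst 2 * 4) `^ ((1 - q) / (p - q)) *
  ((embedding_cst (conj_exp p) * 18 `^ conj_exp p) `^ (q / p)) `^ ((p - 1) / (p - q)).

Section finite_factorization.
Context {R : realType} {I K : finType}.
Variables (D : K -> {set I}) (s w : I -> R) (lam : K -> R) (p q : R).
Hypotheses (q0 : 0 < q) (q1 : q < 1) (p1 : 1 < p).
Hypotheses (lamD : laminar D) (cov : forall i, exists k, i \in D k).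
Hypotheses (s0 : forall i, 0 <= s i) (w0 : forall i, 0 <= w i).
Hypotheses (sP : forall k, 0 < mass D s k) (wP : forall k, 0 < mass D w k).
Hypothesis lamP : forall k, 0 < lam k.

Let p0 : 0 < p. Proof. by move: p1; lra. Qed.
Let pB0 : 0 < p - 1. Proof. by rewrite subr_gt0. Qed.

Lemma disc_op_comb (f g : I -> R) t i :
  disc_op D s lam (fun i => (1 - t) * f i + t * g i) i =
  (1 - t) * disc_op D s lam f i + t * disc_op D s lam g i.
Proof.
rewrite /disc_op !mulr_sumr -big_split/=; apply: eq_bigr => k _.
rewrite /avg [mass D _ k](_ : _ = (1 - t) * mass D (fun i => s i * f i) k +
  t * mass D (fun i => s i * g i) k); first by ring.
by rewrite /mass !mulr_sumr -big_split/=; apply: eq_bigr => j _; ring.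
Qed.

(** A uniform bound on the image of the unit ball, as [maurey_finite] requires; its
    size does not matter. *)
Lemma disc_op_bound (f : I -> R) i : (forall i, 0 <= f i) ->
  \sum_i s i * f i `^ p <= 1 ->
  disc_op D s lam f i <= \sum_k lam k * ((1 + (p - 1) * mass D s k) / p / mass D s k).
Proof.
move=> f0 f1; rewrite /disc_op big_mkcond/=; apply: ler_sum => k _.
have M0 := sP k.
case: ifP => _; last first.
  rewrite mulr_ge0 ?ltW// !divr_gt0//.
  by have : 0 < (p - 1) * mass D s k; [apply: mulr_gt0|lra].
rewrite ler_pM2l// /avg ler_pM2r ?invr_gt0// ler_pdivlMr// mulrC.
apply: (@le_trans _ _ (\sum_(i in D k) s i * (f i `^ p + (p - 1)))).
  rewrite /mass mulr_sumr; apply: ler_sum => j _; rewrite mulrCA; apply: ler_wpM2l => //.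
  by have := young_powR p1 (f0 j) ler01; rewrite !powR1 mul1r mulr1.
rewrite (eq_bigr (fun i => s i * f i `^ p + (p - 1) * s i)) => [|j _]; last by ring.
rewrite big_split/= -mulr_sumr lerD2r (le_trans _ f1)//.
rewrite [leRHS](bigID (mem (D k)))/= lerDl sumr_ge0// => j _.
by rewrite mulr_ge0 ?powR_ge0.
Qed.

Hypothesis norm1 : forall f : I -> R, (forall i, 0 <= f i) ->
  \sum_i w i * disc_op D s lam f i `^ q <= (\sum_i s i * f i `^ p) `^ (q / p).

Lemma finite_factorization : exists v : I -> R,
  [/\ forall i, 0 < v i, \sum_i w i * v i `^ q <= 4 &
   forall f, (forall i, 0 <= f i) -> \sum_i s i * f i `^ p <= 1 ->
     \sum_i w i * v i `^ (q - 1) * disc_op D s lam f i <= 18].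
Proof.
pose U := [set disc_op D s lam f | f in
  [set f : I -> R | (forall i, 0 <= f i) /\ \sum_i s i * f i `^ p <= 1]]%classic.
pose B := \sum_k lam k * ((1 + (p - 1) * mass D s k) / p / mass D s k).
have B0 : 0 <= B.
  apply: sumr_ge0 => k _; rewrite mulr_ge0 ?(ltW (lamP k))// !divr_ge0 ?(ltW (sP k)) ?(ltW p0)//.
  by have : 0 < (p - 1) * mass D s k; [apply: mulr_gt0|lra].
have [|u i [f [f0 f1] <-]|u u' t [f [f0 f1] <-] [g [g0 g1] <-] t01|u [f [f0 f1] <-]|v [v0 vq vU]] :=
  @maurey_finite R I q B w U q0 q1 B0 w0.
- exists (disc_op D s lam (fun=> 0)), (fun=> 0) => //; split=> //.
  by rewrite big1// => i _; rewrite powR0 ?mulr0// gt_eqF.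
- by rewrite disc_op_ge0//= disc_op_bound.
- exists (fun i => (1 - t) * f i + t * g i); last first.
    by apply: boolp.funext => i; rewrite disc_op_comb.
  have /andP[t0 t1] := t01.
  split=> [i|]; first by rewrite addr_ge0// mulr_ge0//; lra.
  apply: (@le_trans _ _ (\sum_i ((1 - t) * (s i * f i `^ p) + t * (s i * g i `^ p)))).
    apply: ler_sum => i _; have := powR_convex_comb p1 (f0 i) (g0 i) t01.
    move=> /(ler_wpM2l (s0 i)) /le_trans; apply.
    by rewrite le_eqVlt; apply/orP; left; apply/eqP; ring.
  by rewrite big_split/= -!mulr_sumr; nra.
- apply: (le_trans (norm1 f0)).
  apply: (@le_trans _ _ (1 `^ (q / p))); last by rewrite powR1.
  apply: ge0_ler_powR; rewrite ?nnegrE//; first by apply: divr_ge0; exact: ltW.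
  by apply: sumr_ge0 => i _; rewrite mulr_ge0 ?powR_ge0.
- exists v; split=> // f f0 f1; apply: vU; exists f; split=> //.
Qed.

End finite_factorization.

(** * Necessity on a finite model *)

Lemma mass_mul_gt0 (R : realType) (I K : finType) (D : K -> {set I})
    (m h : I -> R) k : (forall i, 0 <= m i) -> (forall i, 0 < h i) ->
  0 < mass D m k -> 0 < mass D (fun i => m i * h i) k.
Proof.
move=> m0 h0 mk; have mh0 i : i \in D k -> 0 <= m i * h i.
  by move=> _; rewrite mulr_ge0// ltW.
rewrite lt_neqAle sumr_ge0// andbT eq_sym; apply/negP => /eqP E.
suff : mass D m k = 0 by move=> E'; rewrite E' ltxx in mk.
apply: big1 => i ik; have /eqP := psumr_eq0P mh0 E ik.
by rewrite mulf_eq0 (gt_eqF (h0 i)) orbF => /eqP.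
Qed.

(** Jensen's inequality with the negative exponent q - 1, from Hoelder's inequality applied to
    1 = (v^(q-1))^al (v^(q/2))^(1-al), where al := q / (2 - q) makes the exponents
    cancel.  The positive exponent q/2 < q is what the maximal inequality in
    L^2(omega) can handle, since v is in L^q(omega). *)
Lemma avg_negative_power (R : realType) (I K : finType) (D : K -> {set I})
    (q : R) (w v : I -> R) k : 0 < q -> q < 1 ->
  (forall i, 0 <= w i) -> (forall i, 0 < v i) -> 0 < mass D w k ->
  mass D w k / mass D (fun i => w i * v i `^ (q - 1)) k <=
  avg D w k (fun i => v i `^ (q / 2)) `^ (2 * (1 - q) / q).
Proof.
move=> q0 q1 w0 v0 W0.
set W := mass D w k in W0 *; set A := avg _ _ _ _.
have vq0 i : 0 < v i `^ (q - 1) by rewrite powR_gt0.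
have P0 := mass_mul_gt0 w0 vq0 W0; set P := mass _ _ _ in P0 *.
have A0 : 0 <= A.
  by apply: divr_ge0; [apply: sumr_ge0 => i _; rewrite mulr_ge0 ?powR_ge0|exact: ltW].
pose al := q / (2 - q).
have q2 : 0 < 2 - q by lra.
have al0 : 0 < al by rewrite divr_gt0.
have al1 : al < 1 by rewrite ltr_pdivrMr//; lra.
have := @hoelder_sum R I (fun i => i \in D k) al w (fun i => v i `^ (q - 1))
  (fun i => v i `^ (q / 2)) al0 al1 (fun i _ => w0 i) (fun i _ => powR_ge0 _ _)
  (fun i _ => powR_ge0 _ _).
rewrite (eq_bigr w); last first.
  move=> i _; rewrite -!powRrM -powRD ?(gt_eqF (v0 i)) ?implybT//.
  rewrite (_ : _ + _ = 0) ?powRr0 ?mulr1// /al; field; by rewrite gt_eqF.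
rewrite -/(mass D w k) -/W -/(mass D (fun i => w i * v i `^ (q - 1)) k) -/P.
rewrite (_ : \sum_(i in D k) _ = W * A); last by rewrite /A /avg -/W [RHS]mulrC divfK// gt_eqF.
rewrite powRM// ?(ltW W0)// mulrCA => WP.
have W1 : 0 < W `^ (1 - al) by rewrite powR_gt0.
have {}WP : W `^ al <= P `^ al * A `^ (1 - al).
  rewrite -(ler_pM2l W1) -powRD ?(gt_eqF W0) ?implybT//.
  by rewrite (_ : 1 - al + al = 1) ?powRr1 ?(ltW W0)//; ring.
have aV0 : 0 <= al^-1 by rewrite invr_ge0 ltW.
have := ge0_ler_powR aV0 _ _ WP.
rewrite !nnegrE powR_ge0 mulr_ge0 ?powR_ge0// => /(_ isT isT).
rewrite powRM ?powR_ge0// -!powRrM divff ?gt_eqF// !powRr1 ?(ltW W0) ?(ltW P0)//.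
rewrite (_ : (1 - al) / al = 2 * (1 - q) / q); last first.
  by rewrite /al; field; rewrite !gt_eqF.
by move=> h; rewrite ler_pdivrMr// mulrC.
Qed.

(** The cancellation of mu_Q in the coefficient when a_Q = U / mu_Q, with
    mu_Q = l P / S. *)
Lemma coef_at_choice (R : realType) (r l W S P U : R) :
  0 < r -> 0 < l -> 0 < W -> 0 < S -> 0 < P -> 0 < U ->
  l `^ r * (W / S) `^ (r - 1) * (U / (l * P / S)) `^ (r - 1) =
  l * ((W / P) `^ (r - 1) * U `^ (r - 1)).
Proof.
move=> r0 l0 W0 S0 P0 U0; rewrite -(mulr_powRB1 (ltW l0) r0) -!mulrA; congr (_ * _).
have WS0 : 0 <= W / S by rewrite ltW// divr_gt0.
have WP0 : 0 <= W / P by rewrite ltW// divr_gt0.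
have lP0 : 0 <= U / (l * (P / S)) by rewrite ltW// divr_gt0// mulr_gt0// divr_gt0.
rewrite -(powRM _ WS0 lP0) -(powRM _ (ltW l0) (mulr_ge0 WS0 lP0)).
rewrite -(powRM _ WP0 (ltW U0)); congr (_ `^ _); field; by rewrite !gt_eqF.
Qed.

Section finite_necessity.
Context {R : realType} {I K : finType}.
Variables (D : K -> {set I}) (s w : I -> R) (lam : K -> R) (p q : R).
Hypotheses (q0 : 0 < q) (q1 : q < 1) (p1 : 1 < p).
Hypotheses (lamD : laminar D) (cov : forall i, exists k, i \in D k).
Hypotheses (s0 : forall i, 0 <= s i) (w0 : forall i, 0 <= w i).
Hypotheses (sP : forall k, 0 < mass D s k) (wP : forall k, 0 < mass D w k).
Hypothesis lamP : forall k, 0 < lam k.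
Hypothesis norm1 : forall f : I -> R, (forall i, 0 <= f i) ->
  \sum_i w i * disc_op D s lam f i `^ q <= (\sum_i s i * f i `^ p) `^ (q / p).

(** The coefficients are a k := U k / mu k as explained at the top.  The selections kap and
    kap2 realize the maximal functions, of g for s and of v^(q/2) for w. *)
Lemma finite_necessity_normalized : exists a : K -> R, [/\ forall k, 0 < a k,
  forall k, \sum_(l | D l \subset D k) (a l)^-1 * mass D s l <= mass D s k &
  \sum_i w i * disc_coef D s w lam p a i `^ ((p - 1) * q / (p - q))
    <= necessity_cst p q].
Proof.
have p0 : 0 < p by move: p1; lra.
have p10 : 0 < p - 1 by rewrite subr_gt0.
have pq0 : 0 < p - q by move: p1 q1; lra.
have r1 := conj_exp_gt1 p1; set r := conj_exp p in r1.
have rB0 : 0 < r - 1 by rewrite subr_gt0.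
have r0 : 0 < r by lra.
have [v [v0 vq vT]] := finite_factorization q0 q1 p1 s0 w0 sP lamP norm1.
pose psi i := v i `^ (q - 1).
have psi0 i : 0 < psi i by rewrite powR_gt0.
pose Psi := mass D (fun i => w i * psi i).
have Psi0 k : 0 < Psi k by exact: mass_mul_gt0.
pose mu k := lam k * Psi k / mass D s k.
have mu0 k : 0 < mu k by rewrite divr_gt0// mulr_gt0.
pose g i := \sum_(k | i \in D k) mu k.
have g0 i : 0 <= g i by apply: sumr_ge0 => k _; exact: ltW.
have gr : \sum_i s i * g i `^ r <= 18 `^ r.
  apply: finite_duality => // f f0 f1; apply: le_trans (vT _ f0 f1).
  rewrite sum_mass /disc_op.
  have -> : \sum_i w i * v i `^ (q - 1) * (\sum_(k | i \in D k) lam k * avg D s k f)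
    = \sum_k Psi k * (lam k * avg D s k f) by exact: sum_mass.
  apply: ler_sum => k _; rewrite le_eqVlt; apply/orP; left; apply/eqP.
  by rewrite /mu /avg; field; rewrite gt_eqF.
have [kap kapP] := argmax_cube (fun k => avg D s k g) cov.
pose h i := avg D s (kap i) g.
have h0 i : 0 <= h i by exact: avg_ge0.
have hr : \sum_i s i * h i `^ r <= embedding_cst r * 18 `^ r.
  apply: le_trans (ler_wpM2l (ltW (embedding_cst_gt0 r1)) gr).
  by apply: maximal_inequality => // i; case: (kapP i).
pose z i := v i `^ (q / 2).
have z0 i : 0 <= z i by exact: powR_ge0.
have [kap2 kap2P] := argmax_cube (fun k => avg D w k z) cov.
pose Z i := avg D w (kap2 i) z.
have Z0 i : 0 <= Z i by exact: avg_ge0.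
have Z2 : \sum_i w i * Z i `^ 2 <= embedding_cst 2 * 4.
  have lt12 : 1 < 2 :> R by lra.
  apply: (@le_trans _ _ (embedding_cst 2 * \sum_i w i * z i `^ 2)).
    by apply: maximal_inequality => // i; case: (kap2P i).
  rewrite ler_wpM2l ?(ltW (embedding_cst_gt0 lt12))//.
  apply: le_trans vq; apply: ler_sum => i _; rewrite /z -powRrM divfK//.
have avgg0 k : 0 < avg D s k g.
  rewrite divr_gt0//; have := sP k; move=> /(fun x => @mulr_gt0 _ _ _ x (mu0 k)) => h1.
  apply: (lt_le_trans h1); rewrite /mass mulr_suml; apply: ler_sum => i ik.
  apply: ler_wpM2l => //; rewrite /g (bigD1 k)//= lerDl sumr_ge0// => l _; exact: ltW.
have [tau tauP] : exists tau : K -> K, forall k, D k \subset D (tau k) /\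
    forall l, D k \subset D l -> avg D s l g <= avg D s (tau k) g.
  have sel k : exists l, D k \subset D l /\
      forall l', D k \subset D l' -> avg D s l' g <= avg D s l g.
    case: (@arg_maxP _ _ _ k (fun l => D k \subset D l) (fun l => avg D s l g) (subxx _)).
    by move=> l kl hl; exists l.
  by have [tau tauP] := boolp.choice sel; exists tau.
pose U k := avg D s (tau k) g.
have U0 k : 0 < U k by exact: avgg0.
pose a k := U k / mu k.
have a0 k : 0 < a k by exact: divr_gt0.
exists a; split=> // [k|].
  have := avgg0 k; set G := avg D s k g => G0.
  apply: (@le_trans _ _ (\sum_(l | D l \subset D k) mass D s l * mu l / G)).
    apply: ler_sum => l lk; rewrite /a invf_div mulrAC (mulrC (mu l)).
    apply: ler_wpM2l; first by rewrite mulr_ge0// ltW.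
    by rewrite lef_pV2 ?posrE//; case: (tauP l) => _; apply.
  rewrite -mulr_suml ler_pdivrMr// /G /avg mulrCA divff ?gt_eqF// mulr1.
  rewrite {2}/mass /g; under [leRHS]eq_bigr do rewrite mulr_sumr big_mkcond.
  rewrite exchange_big/= big_mkcond/=; apply: ler_sum => l _.
  case: ifPn => [lk|_]; last first.
    by apply: sumr_ge0 => i _; case: ifP => // _; rewrite mulr_ge0// ltW.
  rewrite /mass mulr_suml [leRHS](big_setID (D l))/= (finset.setIidPr lk).
  rewrite [X in _ <= X + _](eq_bigr (fun i => s i * mu l)); last by move=> i ->.
  by rewrite lerDl; apply: sumr_ge0 => i _; case: ifP => // _; rewrite mulr_ge0// ltW.
pose f i := h i `^ (r - 1).
have f0 i : 0 <= f i by exact: powR_ge0.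
(* The exponent of [avg_negative_power], raised to the power r - 1. *)
pose ka := 2 * (1 - q) / q * (r - 1).
have coefle i : disc_coef D s w lam p a i <= Z i `^ ka * disc_op D s lam f i.
  rewrite /disc_coef /disc_op mulr_sumr; apply: ler_sum => k ik.
  have -> : lam k `^ conj_exp p * (mass D w k / mass D s k) `^ (conj_exp p - 1) *
     a k `^ (conj_exp p - 1) = lam k * ((mass D w k / Psi k) `^ (r - 1) * U k `^ (r - 1)).
    exact: coef_at_choice.
  rewrite [leRHS]mulrCA; apply: ler_wpM2l; first exact: ltW.
  apply: ler_pM; rewrite ?powR_ge0//.
    rewrite /ka powRrM; apply: ge0_ler_powR; rewrite ?nnegrE ?powR_ge0 ?(ltW rB0)//.
      by rewrite divr_ge0// ltW.
    apply: (le_trans (avg_negative_power q0 q1 w0 v0 (wP k))).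
    apply: ge0_ler_powR; rewrite ?nnegrE ?avg_ge0//.
      by rewrite divr_ge0 ?(ltW q0)// mulr_ge0// subr_ge0 ltW.
    by case: (kap2P i) => _; apply.
  rewrite /avg ler_pdivlMr// /mass mulr_sumr; apply: ler_sum => j jk.
  rewrite mulrC; apply: ler_wpM2l => //.
  apply: ge0_ler_powR; rewrite ?nnegrE ?(ltW rB0) ?(ltW (U0 k))//.
  case: (kapP j) => _; apply; case: (tauP k) => /fintype.subsetP sub _; exact: sub.
(* Hoelder exponent: ka times (p - 1) q / (p - q) is 2 be, and the same power of the
   operator is the power 1 - be of its q-th power. *)
pose be := (1 - q) / (p - q).
have be0 : 0 < be by rewrite divr_gt0// subr_gt0.
have be1 : be < 1 by rewrite ltr_pdivrMr//; move: p1; lra.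
have beE : 1 - be = (p - 1) / (p - q) by rewrite /be; field; rewrite gt_eqF.
set th := (p - 1) * q / (p - q).
have Tf0 i : 0 <= disc_op D s lam f i by exact: disc_op_ge0.
have th0 : 0 <= th by rewrite divr_ge0 ?mulr_ge0 ?(ltW q0) ?(ltW p10) ?(ltW pq0).
apply: (@le_trans _ _ (\sum_i w i * ((Z i `^ 2) `^ be * (disc_op D s lam f i `^ q) `^ (1 - be)))).
  apply: ler_sum => i _; apply: ler_wpM2l => //.
  rewrite -!powRrM.
  have -> : 2 * be = ka * th.
    by rewrite /be /ka /th conj_expB1//; field; rewrite !gt_eqF.
  have -> : q * (1 - be) = th by rewrite beE /th; ring.
  rewrite [_ `^ (ka * _)]powRrM -powRM ?powR_ge0//.
  apply: ge0_ler_powR; rewrite ?nnegrE.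
  - exact: th0.
  - by apply: sumr_ge0 => k _; rewrite !mulr_ge0 ?powR_ge0.
  - by rewrite mulr_ge0 ?powR_ge0.
  - exact: coefle.
apply: (le_trans (hoelder_sum _ _ _ _ _)) => // [i _|i _|]; [exact: powR_ge0..|].
rewrite /necessity_cst -/r -/be -beE; apply: ler_pM; rewrite ?powR_ge0//.
  apply: ge0_ler_powR; rewrite ?nnegrE ?(ltW be0)//.
    by apply: sumr_ge0 => i _; rewrite mulr_ge0 ?powR_ge0.
  by rewrite mulr_ge0 ?divr_ge0 ?powR_ge0//; lra.
apply: ge0_ler_powR; rewrite ?nnegrE ?powR_ge0//.
- by rewrite subr_ge0 ltW.
- by apply: sumr_ge0 => i _; rewrite mulr_ge0 ?powR_ge0.
apply: (le_trans (norm1 f0)).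
have fp : \sum_i s i * f i `^ p = \sum_i s i * h i `^ r.
  by apply: eq_bigr => i _; rewrite /f -powRrM conj_expM.
rewrite fp; apply: ge0_ler_powR; rewrite ?nnegrE//.
- by rewrite divr_ge0 ?(ltW q0) ?(ltW p0).
- by apply: sumr_ge0 => i _; rewrite mulr_ge0 ?powR_ge0.
- by rewrite mulr_ge0 ?powR_ge0// ltW// embedding_cst_gt0.
Qed.

End finite_necessity.

(** The general case is [finite_necessity_normalized] for lambda / N; the power of N comes
    from the homogeneity of degree p' of the coefficient. *)
Lemma finite_necessity (R : realType) (I K : finType) (D : K -> {set I})
    (s w : I -> R) (lam : K -> R) (p q N : R) :
  0 < q -> q < 1 -> 1 < p -> laminar D -> (forall i, exists k, i \in D k) ->
  (forall i, 0 <= s i) -> (forall i, 0 <= w i) ->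
  (forall k, 0 < mass D s k) -> (forall k, 0 < mass D w k) ->
  (forall k, 0 < lam k) -> 0 < N ->
  (forall f : I -> R, (forall i, 0 <= f i) ->
    \sum_i w i * disc_op D s lam f i `^ q
      <= N `^ q * (\sum_i s i * f i `^ p) `^ (q / p)) ->
  exists a : K -> R, [/\ forall k, 0 < a k,
    forall k, \sum_(l | D l \subset D k) (a l)^-1 * mass D s l <= mass D s k &
    \sum_i w i * disc_coef D s w lam p a i `^ ((p - 1) * q / (p - q))
      <= necessity_cst p q * N `^ (p * q / (p - q))].
Proof.
move=> q0 q1 p1 lamD cov s0 w0 sP wP lamP N0 norm.
have pq0 : 0 < p - q by lra.
have p10 : 0 < p - 1 by lra.
have NV0 : 0 <= N^-1 by rewrite invr_ge0 ltW.
pose lam' k := lam k / N.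
have lam'P k : 0 < lam' k by rewrite divr_gt0.
have opE f i : disc_op D s lam' f i = disc_op D s lam f i * N^-1.
  by rewrite /disc_op mulr_suml; apply: eq_bigr => k _; rewrite mulrAC.
have [f f0|a [a0 ca Ba]] :=
    finite_necessity_normalized q0 q1 p1 lamD cov s0 w0 sP wP lam'P.
  rewrite (eq_bigr (fun i => w i * disc_op D s lam f i `^ q * N^-1 `^ q)); last first.
    by move=> i _; rewrite opE powRM ?disc_op_ge0// mulrA.
  rewrite -mulr_suml invr_powR ?(ltW N0)// ler_pdivrMr ?powR_gt0// mulrC.
  by rewrite mulrC [leRHS]mulrC; exact: norm.
exists a; split=> //; set th := (p - 1) * q / (p - q).
have coefE i : disc_coef D s w lam p a i = N `^ conj_exp p * disc_coef D s w lam' p a i.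
  rewrite /disc_coef mulr_sumr; apply: eq_bigr => k _.
  rewrite [in RHS]/lam' (powRM _ (ltW (lamP k)) NV0) (invr_powR _ (ltW N0)); field.
  by rewrite gt_eqF// powR_gt0.
rewrite (eq_bigr (fun i => w i * disc_coef D s w lam' p a i `^ th
    * N `^ (p * q / (p - q)))); last first.
  move=> i _; rewrite coefE powRM ?powR_ge0//; last first.
    by apply: sumr_ge0 => k _; rewrite !mulr_ge0 ?powR_ge0.
  rewrite -powRrM (_ : conj_exp p * th = p * q / (p - q)); first by ring.
  by rewrite /conj_exp /th; field; rewrite !gt_eqF.
by rewrite -mulr_suml ler_wpM2r// powR_ge0.
Qed.

(** * Dyadic cubes *)

Local Open Scope classical_set_scope.

Section dyadic.
Context {R : realType} {d : nat}.
Implicit Types (k : int) (j : 'I_d -> int) (x : 'rV[R]_d).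

Lemma scale_gt0 k : 0 < (2 : R) ^ k.
Proof. by rewrite exprz_gt0. Qed.

Lemma dyadic_cubeP k j x : @dyadic_cube R d k j x <->
  forall i, 2 ^ k * (j i)%:~R <= x ord0 i < 2 ^ k * ((j i)%:~R + 1).
Proof.
have c0 := scale_gt0 k; split.
  case=> y /= yP <- i; rewrite !mxE.
  by have /andP[h1 h2] := yP i; rewrite ler_pM2l// ltr_pM2l//; apply/andP; split; lra.
move=> xP; exists (\row_i (x ord0 i / 2 ^ k - (j i)%:~R)) => /=.
  move=> i; rewrite mxE; have /andP[h1 h2] := xP i.
  rewrite subr_ge0 ler_pdivlMr// mulrC h1/= ltrBlDr ltr_pdivrMr//.
  by rewrite mulrC addrC.
apply/rowP => i; rewrite !mxE subrK mulrC divfK// gt_eqF//.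
Qed.

(** In units of the smaller side length, the ends of both cubes are integers, so the
    strict inequalities at a common point turn into inclusions of intervals. *)
Lemma dyadic_cube_nested k k' j j' x : (k <= k')%R ->
  @dyadic_cube R d k j x -> @dyadic_cube R d k' j' x ->
  @dyadic_cube R d k j `<=` @dyadic_cube R d k' j'.
Proof.
move=> kk' /dyadic_cubeP xk /dyadic_cubeP xk' z /dyadic_cubeP zk.
apply/dyadic_cubeP => i.
have c0 := scale_gt0 k.
pose m := `|k' - k|%N.
have cE : (2 : R) ^ k' = 2 ^ k * (2 ^+ m)%:~R.
  have -> : k' = k + m%:Z by rewrite /m gez0_abs ?subr_ge0//; ring.
  by rewrite expfzDr// -exprnP rmorphXn.
have /andP[x1 x2] := xk i; have /andP[x3 x4] := xk' i; have /andP[z1 z2] := zk i.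
rewrite cE -!mulrA in x3 x4 *.
have {}x3 : ((2 ^+ m)%:~R : R) * (j' i)%:~R < (j i)%:~R + 1.
  by rewrite -(ltr_pM2l c0); exact: le_lt_trans x2.
have {}x4 : (j i)%:~R < ((2 ^+ m)%:~R : R) * ((j' i)%:~R + 1).
  by rewrite -(ltr_pM2l c0); exact: le_lt_trans x4.
have h3 : 2 ^+ m * j' i <= j i.
  by rewrite -ltzD1 -(ltr_int R) rmorphM rmorphD/=.
have h4 : j i + 1 <= 2 ^+ m * (j' i + 1).
  by rewrite addrC lez1D -(ltr_int R) rmorphM rmorphD/=.
rewrite -(ler_int R) rmorphM/= in h3; rewrite -(ler_int R) rmorphM !rmorphD/= in h4.
apply/andP; split.
  by rewrite -(ler_pM2l c0) in h3; exact: le_trans h3 z1.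
by rewrite -(ler_pM2l c0) in h4; exact: lt_le_trans z2 h4.
Qed.

Lemma dyadic_laminar (Q S : set 'rV[R]_d) : dyadic Q -> dyadic S ->
  Q `<=` S \/ S `<=` Q \/ Q `&` S = set0.
Proof.
move=> [k [j ->]] [k' [j' ->]].
have [[x [xk xk']]|kk0] :=
  pselect ((@dyadic_cube R d k j `&` @dyadic_cube R d k' j') !=set0); last first.
  by right; right; apply/seteqP; split => x // xx; apply: kk0; exists x.
have [kk'|/ltW kk'] := leP k k'.
  by left; exact: dyadic_cube_nested xk xk'.
by right; left; exact: dyadic_cube_nested xk' xk.
Qed.

Lemma coord_open (i : 'I_d) (b : R) : open [set x : 'rV[R]_d | x ord0 i < b].
Proof.
apply: (@open_comp _ _ (fun x : 'rV[R]_d => x ord0 i) [set y | y < b]).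
  by move=> x _; exact: coord_continuous.
exact: open_lt.
Qed.

Lemma measurable_dyadic (Q : set 'rV[R]_d) : dyadic Q ->
  measurable (Q : set (borel_space R d)).
Proof.
move=> [k [j ->]].
have mlt i b : measurable ([set x : 'rV[R]_d | x ord0 i < b] : set (borel_space R d)).
  by apply: sub_sigma_algebra; exact: coord_open.
rewrite (_ : @dyadic_cube R d k j = \bigcap_(i in [set: 'I_d])
  (~` [set x : 'rV[R]_d | x ord0 i < 2 ^ k * (j i)%:~R] `&`
   [set x : 'rV[R]_d | x ord0 i < 2 ^ k * ((j i)%:~R + 1)])).
  apply: (@fin_bigcap_measurable _ (borel_space R d)) => // i _.
  by apply: measurableI => //; exact: measurableC.
apply/seteqP; split => [x /dyadic_cubeP xP i _|x xP].
  by have /andP[h1 h2] := xP i; split => //=; apply/negP; rewrite -leNgt.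
apply/dyadic_cubeP => i; have [/= /negP h1 h2] := xP i I.
by rewrite leNgt h1.
Qed.

Local Open Scope ereal_scope.

(** Measurability and finiteness are proved together because subadditivity needs both. *)
Lemma finite_bigcup_lty (mu : {measure set (borel_space R d) -> \bar R})
    (s : seq 'rV[R]_d) (U : 'rV[R]_d -> set 'rV[R]_d) :
  (forall x, open (U x) /\ mu (U x) < +oo) ->
  measurable (\bigcup_(x in [set` s]) U x : set (borel_space R d)) /\
  mu (\bigcup_(x in [set` s]) U x) < +oo.
Proof.
move=> UP; rewrite bigcup_seq.
have mU x : measurable (U x : set (borel_space R d)).
  by apply: sub_sigma_algebra; case: (UP x).
elim: s => [|x s [mI fI]]; first by rewrite big_nil measure0.
rewrite big_cons; split; first exact: measurableU.
apply: (le_lt_trans (measureU2 mu (mU x) mI)).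
by rewrite lte_add_pinfty//; case: (UP x).
Qed.

(** The closure of a dyadic cube is compact, hence covered by finitely many open sets of
    finite measure. *)
Lemma dyadic_lty (mu : {measure set (borel_space R d) -> \bar R}) (Q : set 'rV[R]_d) :
  locally_finite mu -> dyadic Q -> mu Q < +oo.
Proof.
move=> lf dQ; have mQ := measurable_dyadic dQ; move: dQ mQ => [k [j ->]] mQ.
pose seg i := [set y : R | y \in
  `[(2 ^ k * (j i)%:~R)%R, (2 ^ k * ((j i)%:~R + 1))%R]%R].
have cK : compact [set x : 'rV[R]_d | forall i, seg i (x ord0 i)].
  by apply: rV_compact => i; exact: segment_compact.
have sel x : exists U : set 'rV[R]_d, [/\ open U, U x & mu U < +oo].
  by have [U [oU Ux] fU] := lf x; exists U.
have [U UP] := boolp.choice sel.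
have cov := cK; rewrite compact_cover in cov.
have [x _|x _|D' _ KD] := cov _ setT U.
- by have [] := UP x.
- by exists x => //; have [] := UP x.
have UP' x : open (U x) /\ mu (U x) < +oo by have [] := UP x.
have [mD fD] := @finite_bigcup_lty mu (finmap.enum_fset D') U UP'.
apply: le_lt_trans fD; apply: le_measure; rewrite ?inE//.
move=> x /dyadic_cubeP xQ; apply: KD => i /=; rewrite /seg/= in_itv/=.
by have /andP[-> /ltW ->] := xQ i.
Qed.

End dyadic.

(** * Limits of coefficients *)

(** A limit along an ultrafilter exists at all points of P at once.  Only the comparison up
    to a factor 2 is kept: it is what the packing condition and the integral condition need,
    and it holds for all members of a finite list at one common index n. *)
Lemma pointwise_limit_coefficients (R : realType) (X : eqType) (P : set X)
    (x : nat -> X -> R) :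
  (forall Q, P Q -> exists K m, forall n, (m <= n)%N -> 1 <= x n Q <= K) ->
  exists a : X -> R, (forall Q, P Q -> 1 <= a Q) /\
    forall (L : seq X) m, (forall Q, Q \in L -> P Q) ->
    exists n, (m <= n)%N /\ forall Q, Q \in L -> a Q / 2 <= x n Q <= 2 * a Q.
Proof.
move=> bd.
have [G [uG leG]] := ultraFilterLemma eventually_filter.
have pG : ProperFilter G by exact: ultra_proper.
have lim Q : exists aQ, P Q -> 1 <= aQ /\ G [set n | aQ / 2 <= x n Q <= 2 * aQ].
  have [PQ|nPQ] := pselect (P Q); last by exists 0.
  have [K [m xK]] := bd Q PQ.
  (* The limit is a cluster point in a compact segment; the ultrafilter contains every
     neighbourhood of it. *)
  have GK : ((fun n => x n Q) @ G) `[1, K]%classic.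
    apply: leG; exists m => // n /= mn; rewrite in_itv/=; exact: xK.
  have [a [aK cla]] := @segment_compact R 1 K _ _ GK.
  have a1 : 1 <= a by move: aK => /=; rewrite in_itv/= => /andP[].
  exists a => _; split=> //.
  set S := [set n | _].
  case: (in_ultra_setVsetC S uG) => [//|GS].
  have Na : nbhs a `](a / 2), (2 * a)[%classic.
    apply: near_in_itvoo; rewrite in_itv/=; apply/andP; split; lra.
  have sub : ~` S `<=` (fun n => x n Q) @^-1` (~` `](a / 2), (2 * a)[%classic).
    move=> n nS /= xn; apply: nS; move: xn; rewrite in_itv/=.
    by move=> /andP[/ltW h1 /ltW h2]; apply/andP.
  have GN : ((fun n => x n Q) @ G) (~` `](a / 2), (2 * a)[%classic) by exact: filterS sub GS.
  by have [y []] := cla _ _ GN Na.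
have [a aP] := boolp.choice lim.
exists a; split => [Q /aP[]//|L m LP].
suff GL : G [set n | (m <= n)%N /\ forall Q, Q \in L -> a Q / 2 <= x n Q <= 2 * a Q].
  by have [n] := @filter_ex _ _ pG _ GL; exists n.
elim: L LP => [|Q L IH] LP.
  by apply: leG; exists m => // n /= mn; split.
have PQ : P Q by apply: LP; rewrite mem_head.
have /IH GL Q' : Q' \in L -> P Q' by move=> Q'L; apply: LP; rewrite inE Q'L orbT.
have [_ GQ] := aP Q PQ.
apply: filterS (filterI GL GQ) => n [[mn nL] nQ]; split=> // Q'.
by rewrite inE => /predU1P[->|/nL].
Qed.

(** * The finite model generated by finitely many sets *)

Local Open Scope ereal_scope.

Section atoms.
Context {d : measure_display} {T : measurableType d} {R : realType} {n : nat}.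
Variable Q : 'I_n -> set T.

(** The set of the given sets that contain x; two points are in the same atom when
    their codes agree. *)
Definition code (x : T) : {set 'I_n} := [set k | `[< Q k x >]]%SET.

(** Only codes that occur are kept, so that inclusion of sets of atoms is the same as
    inclusion of the sets themselves ([atoms_subset]); the empty code is discarded because the
    complement of the union may have infinite measure. *)
Definition code_pred (A : {set 'I_n}) : bool :=
  `[< exists x, code x = A >] && (A != finset.set0).

Definition atom_index := {A : {set 'I_n} | code_pred A}.

Definition atom (i : atom_index) : set T := [set x | code x = val i].

Definition atoms_of (k : 'I_n) : {set atom_index} := [set i : atom_index | k \in val i]%SET.

Lemma in_code k x : (k \in code x) = `[< Q k x >].
Proof. by rewrite inE. Qed.

Lemma cube_atom k x : Q k x -> exists2 i, atom i x & i \in atoms_of k.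
Proof.
move=> Qx; have kx : k \in code x by rewrite in_code; apply/asboolP.
have Cx : code_pred (code x).
  apply/andP; split; first by apply/asboolP; exists x.
  by apply/eqP => E; rewrite E inE in kx.
by exists (exist (fun A => code_pred A) _ Cx); rewrite ?inE.
Qed.

Lemma atom_cube i k x : atom i x -> i \in atoms_of k <-> Q k x.
Proof.
by move=> ix; rewrite inE -ix in_code; split => [/asboolP|h]; [|apply/asboolP].
Qed.

Lemma atom_nonempty i : exists x, atom i x.
Proof. by case: i => A CA /=; have /andP[/asboolP[x xA] _] := CA; exists x. Qed.

Lemma atom_inj i j x : atom i x -> atom j x -> i = j.
Proof. by move=> ix jx; apply: val_inj; rewrite -ix -jx. Qed.

Lemma atom_cover i : exists k, i \in atoms_of k.
Proof.
have /andP[_ /finset.set0Pn[k ki]] := valP i.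
by exists k; rewrite inE.
Qed.

Lemma atoms_subset k l : atoms_of k \subset atoms_of l <-> Q k `<=` Q l.
Proof.
split=> [/fintype.subsetP kl x /cube_atom[i ix /kl il]|kl].
  exact/(atom_cube _ ix).
apply/fintype.subsetP => i; have [x ix] := atom_nonempty i.
by move=> /(atom_cube _ ix)/kl/(atom_cube _ ix).
Qed.

Lemma atoms_laminar :
  (forall k l, Q k `<=` Q l \/ Q l `<=` Q k \/ Q k `&` Q l = set0) ->
  laminar atoms_of.
Proof.
move=> lam k l; case: (lam k l) => [/atoms_subset ->//|[/atoms_subset ->|kl0]].
  by rewrite orbT.
apply/or3P; apply: Or33; apply/pred0P => i /=; apply/negP => /andP[ik il].
have [x ix] := atom_nonempty i.
have : (Q k `&` Q l) x by split; exact/(atom_cube _ ix).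
by rewrite kl0.
Qed.

Lemma atoms_exhaust x : (exists i, atom i x) \/ (forall k, ~ Q k x).
Proof.
have [[k Qk]|/forallNP] := EM (exists k, Q k x); last by right.
by left; have [i] := cube_atom Qk; exists i.
Qed.

Hypothesis mQ : forall k, measurable (Q k).

Lemma measurable_atom i : measurable (atom i).
Proof.
rewrite (_ : atom i = \bigcap_(k in [set: 'I_n])
   (if k \in val i then Q k else ~` Q k)).
  apply: fin_bigcap_measurable => // k _; case: ifP => _ //; exact: measurableC.
apply/seteqP; split => [x ix k _|x ix].
  rewrite -ix in_code; case: ifPn => /asboolP //.
apply/setP => k; have := ix k I; rewrite in_code.
by case: ifPn => _ ?; apply/asboolP.
Qed.

Definition step (h : atom_index -> R) (x : T) : R := (\sum_i h i * \1_(atom i) x)%R.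

Lemma step_atom h i x : atom i x -> step h x = h i.
Proof.
move=> ix; rewrite /step (bigD1 i)//= indicE mem_set// mulr1 big1 ?addr0// => j ji.
by rewrite indicE memNset ?mulr0// => jx; rewrite (atom_inj ix jx) eqxx in ji.
Qed.

Lemma step_out h x : (forall k, ~ Q k x) -> step h x = 0%R.
Proof.
move=> Qx; rewrite /step big1// => i _; rewrite indicE memNset ?mulr0// => ix.
have [k ik] := atom_cover i; exact: (Qx k ((atom_cube _ ix).1 ik)).
Qed.

Lemma step_ge0 h x : (forall i, 0 <= h i)%R -> (0 <= step h x)%R.
Proof. by move=> h0; apply: sumr_ge0 => i _; rewrite mulr_ge0. Qed.

Lemma measurable_step h : measurable_fun setT (step h).
Proof.
apply: measurable_sum => i; apply: measurable_funM => //.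
by apply: measurable_indic; exact: measurable_atom.
Qed.

Lemma integral_step (mu : {measure set T -> \bar R}) h : (forall i, 0 <= h i)%R ->
  \int[mu]_x (step h x)%:E = \sum_i (h i)%:E * mu (atom i).
Proof.
move=> h0; under eq_integral do rewrite /step -sumEFin.
rewrite ge0_integral_sum//=; first last.
- by move=> i x _; rewrite lee_fin mulr_ge0.
- move=> i; apply/measurable_EFinP; apply: measurable_funM => //.
  by apply: measurable_indic; exact: measurable_atom.
apply: eq_bigr => i _; under eq_integral do rewrite EFinM.
rewrite ge0_integralZl_EFin//=.
- by rewrite integral_indic// ?setIT//; exact: measurable_atom.
- by apply/measurable_EFinP; apply: measurable_indic; exact: measurable_atom.
Qed.

Section weights.
Variable mu : {measure set T -> \bar R}.
Hypothesis finQ : forall k, mu (Q k) < +oo.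

Definition weight i : R := fine (mu (atom i)).

Lemma weight_ge0 i : (0 <= weight i)%R.
Proof. exact: fine_ge0. Qed.

Lemma atom_fin_num i : mu (atom i) \is a fin_num.
Proof.
have [k ik] := atom_cover i; rewrite ge0_fin_numE//; apply: le_lt_trans (finQ k).
apply: le_measure; rewrite ?inE//; first exact: measurable_atom.
by move=> x ix; apply/(atom_cube _ ix).
Qed.

Lemma weightE i : (weight i)%:E = mu (atom i).
Proof. by rewrite fineK// atom_fin_num. Qed.

Lemma integral_step_fin h : (forall i, 0 <= h i)%R ->
  \int[mu]_x (step h x)%:E = (\sum_i weight i * h i)%:E.
Proof.
move=> h0; rewrite integral_step// -sumEFin; apply: eq_bigr => i _.
by rewrite EFinM weightE muleC.
Qed.

Lemma integral_step_cube h k : (forall i, 0 <= h i)%R ->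
  \int[mu]_(x in Q k) (step h x)%:E = (mass atoms_of (fun i => weight i * h i)%R k)%:E.
Proof.
move=> h0; rewrite integral_mkcond.
rewrite (_ : (_ \_ _) = fun x => (step (fun i => if i \in atoms_of k then h i else 0%R) x)%:E).
  rewrite integral_step_fin//; last by move=> i; case: ifP.
  by rewrite /mass [in RHS]big_mkcond; congr _%:E; apply: eq_bigr => i _; case: ifP; rewrite ?mulr0.
apply/funext => x; rewrite patchE; have [[i ix]|Qx] := atoms_exhaust x.
  rewrite (step_atom _ ix) (step_atom _ ix); case: ifPn => [|].
    by rewrite inE => /(atom_cube _ ix) ->.
  by rewrite notin_setE; case: ifPn => // /(atom_cube _ ix).
by rewrite memNset// step_out.
Qed.

Lemma mass_weight k : (mass atoms_of weight k)%:E = mu (Q k).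
Proof.
rewrite -[mu (Q k)](_ : \int[mu]_(x in Q k) (step (fun=> 1%R) x)%:E = _).
  by rewrite integral_step_cube//; congr _%:E; apply: eq_bigr => i _; rewrite mulr1.
rewrite (eq_integral (cst 1)).
  by rewrite integral_cst// mul1e.
by move=> x; rewrite inE => /cube_atom[i ix _]; rewrite (step_atom _ ix).
Qed.

End weights.
End atoms.

Section discretization.
Context {d : measure_display} {T : measurableType d} {R : realType} {n : nat}.
Variable Q : 'I_n -> set T.
Hypothesis mQ : forall k, measurable (Q k).
Variable mu : {measure set T -> \bar R}.
Hypothesis finQ : forall k, mu (Q k) < +oo.

Lemma integral_atoms (f : T -> \bar R) (S : {set atom_index Q}) (E : set T) :
  measurable_fun setT f -> (forall x, 0 <= f x) ->
  E = \bigcup_(i in [set` enum S]) atom i ->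
  \int[mu]_(x in E) f x = \sum_(i in S) \int[mu]_(x in atom i) f x.
Proof.
move=> mf f0 ->; rewrite bigcup_seq ge0_integral_bigsetU ?enum_uniq//.
- by rewrite big_enum.
- exact: measurable_atom.
- by move=> i j _ _ [x [ix jx]]; exact: atom_inj ix jx.
- exact: measurable_funTS.
Qed.

Lemma cube_atoms k : Q k = \bigcup_(i in [set` enum (atoms_of Q k)]) atom i.
Proof.
apply/seteqP; split => [x /cube_atom[i ix ik]|x [i]/=].
  by exists i => //=; rewrite mem_enum.
by rewrite mem_enum => ik ix; apply/(atom_cube _ ix).
Qed.

(** The integrated tangent inequality.  It gives both the finiteness of the integral of f
    over E (take t = 1) and Jensen's inequality (take t equal to the average). *)
Lemma integral_tangent (p t : R) (f : T -> R) (E : set T) : (1 < p)%R -> (0 <= t)%R ->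
  measurable E -> measurable_fun setT f -> (forall x, 0 <= f x)%R ->
  (p * t `^ (p - 1))%:E * \int[mu]_(x in E) (f x)%:E <=
  \int[mu]_(x in E) (f x `^ p)%:E + ((p - 1) * t `^ p)%:E * mu E.
Proof.
move=> p1 t0 mE mf f0.
have c0 : (0 <= (p - 1) * t `^ p)%R by rewrite mulr_ge0 ?powR_ge0//; lra.
have mfE : measurable_fun E (EFin \o f).
  by apply/measurable_EFinP; exact: measurable_funTS.
have mfp : measurable_fun E (fun x => (f x `^ p)%:E).
  apply/measurable_EFinP; apply: (measurableT_comp (measurable_powR _)).
  exact: measurable_funTS.
rewrite -ge0_integralZl_EFin//; first last.
- by rewrite mulr_ge0 ?powR_ge0//; lra.
- by move=> x _; rewrite lee_fin.
rewrite -integral_cst// -ge0_integralD//; first last.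
  by move=> x _; rewrite lee_fin powR_ge0.
apply: ge0_le_integral => //.
- by move=> x _; rewrite -EFinM lee_fin !mulr_ge0 ?powR_ge0//; lra.
- exact: measurable_funeM.
- exact: emeasurable_funD.
move=> x _ /=; rewrite -EFinM -EFinD lee_fin -mulrA; exact: young_powR.
Qed.

(** The conditional expectation of f on the atoms; on an atom of measure 0 it is 0. *)
Definition cond_avg (f : T -> R) (i : atom_index Q) : R :=
  (fine (\int[mu]_(x in atom i) (f x)%:E) / weight mu i)%R.

Section cond_avg.
Variables (p : R) (f : T -> R).
Hypothesis p1 : (1 < p)%R.
Hypothesis mf : measurable_fun setT f.
Hypothesis f0 : forall x, (0 <= f x)%R.
Hypothesis fp : \int[mu]_x (f x `^ p)%:E < +oo.

Let mfp : measurable_fun setT (fun x => (f x `^ p)%:E).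
Proof.
by apply/measurable_EFinP; apply: (measurableT_comp (measurable_powR _)).
Qed.

Let mfE : measurable_fun setT (EFin \o f).
Proof. exact/measurable_EFinP. Qed.

Lemma cond_avg_ge0 i : (0 <= cond_avg f i)%R.
Proof.
rewrite divr_ge0 ?weight_ge0// fine_ge0//.
by apply: integral_ge0 => x _; rewrite lee_fin.
Qed.

Lemma integral_atom_fin_num (i : atom_index Q) : \int[mu]_(x in atom i) (f x)%:E \is a fin_num.
Proof.
rewrite ge0_fin_numE; last by apply: integral_ge0 => x _; rewrite lee_fin.
have mi := measurable_atom mQ i.
have := @integral_tangent p 1 f _ p1 ler01 mi mf f0.
rewrite !powR1 !mulr1 -lee_pdivlMl; last by move: p1; lra.
move=> /le_lt_trans; apply; rewrite lte_mul_pinfty ?lee_fin ?invr_ge0//; first by move: p1; lra.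
rewrite lte_add_pinfty//.
  apply: le_lt_trans fp; apply: ge0_subset_integral => // x _.
  by rewrite lee_fin powR_ge0.
rewrite lte_mul_pinfty ?lee_fin//; first by move: p1; lra.
by have := atom_fin_num mQ finQ i; rewrite ge0_fin_numE.
Qed.

Lemma cond_avgE (i : atom_index Q) :
  \int[mu]_(x in atom i) (f x)%:E = (weight mu i * cond_avg f i)%:E.
Proof.
have mi := measurable_atom mQ i.
have [w0|wN0] := eqVneq (weight mu i) 0%R.
  rewrite w0 mul0r null_set_integral//; first exact: measurable_funTS.
  by rewrite -weightE// w0.
by rewrite mulrC divfK// fineK// integral_atom_fin_num.
Qed.

Lemma cond_avg_cube k :
  \int[mu]_(x in Q k) (f x)%:E = (mass (atoms_of Q) (fun i => weight mu i * cond_avg f i)%R k)%:E.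
Proof.
rewrite (integral_atoms mfE _ (cube_atoms k)); last by move=> x; rewrite lee_fin.
by rewrite -sumEFin; apply: eq_bigr => i _; exact: cond_avgE.
Qed.

Lemma cond_avg_jensen :
  (\sum_i weight mu i * cond_avg f i `^ p)%:E <= \int[mu]_x (f x `^ p)%:E.
Proof.
have f0' x : 0 <= (f x `^ p)%:E by rewrite lee_fin powR_ge0.
have mU : measurable (\bigcup_(i in [set` enum [set: atom_index Q]%SET]) atom i).
  by apply: fin_bigcup_measurable => // i _; exact: measurable_atom.
apply: (@le_trans _ _ (\sum_(i in [set: atom_index Q]%SET)
    \int[mu]_(x in atom i) (f x `^ p)%:E)); last first.
  rewrite -(integral_atoms mfp f0' erefl).
  by apply: ge0_subset_integral.
rewrite -sumEFin (eq_bigl (fun i => i \in [set: atom_index Q]%SET)); last by move=> i; rewrite inE.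
apply: lee_sum => i _; have c0 := cond_avg_ge0 i.
have := @integral_tangent p (cond_avg f i) f _ p1 c0 (measurable_atom mQ i) mf f0.
rewrite cond_avgE -weightE// -!EFinM.
rewrite (_ : (p * _ * _)%R = ((weight mu i * cond_avg f i `^ p)
    + (p - 1) * cond_avg f i `^ p * weight mu i)%R).
  by rewrite EFinD leeD2rE.
have p0 : (0 < p)%R by move: p1; lra.
by rewrite -(mulr_powRB1 c0 p0); ring.
Qed.

End cond_avg.
End discretization.

Definition op_term {d} {T : measurableType d} {R : realType}
    (sigma : {measure set T -> \bar R}) (lam : set T -> R) (f : T -> R) (x : T)
    (Q : set T) : \bar R :=
  (lam Q)%:E * ((sigma Q)^-1 * \int[sigma]_(y in Q) (f y)%:E) * (\1_Q x)%:E.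

Definition coef_term {d} {T : measurableType d} {R : realType}
    (sigma omega : {measure set T -> \bar R}) (lam : set T -> R) (p : R)
    (a : set T -> R) (x : T) (Q : set T) : \bar R :=
  (lam Q `^ conj_exp p)%:E * (omega Q / sigma Q) `^ (conj_exp p - 1)
  * (a Q `^ (conj_exp p - 1))%:E * (\1_Q x)%:E.

Section finite_family.
Context {d : measure_display} {T : measurableType d} {R : realType} {n : nat}.
Variable Q : 'I_n -> set T.
Hypothesis mQ : forall k, measurable (Q k).
Hypothesis lamQ : forall k l, Q k `<=` Q l \/ Q l `<=` Q k \/ Q k `&` Q l = set0.
Variables sigma omega : {measure set T -> \bar R}.
Hypothesis sQ : forall k, 0 < sigma (Q k) < +oo.
Hypothesis wQ : forall k, 0 < omega (Q k) < +oo.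
Variable lam : set T -> R.
Hypothesis lamP : forall k, (0 < lam (Q k))%R.
Variables (p q : R).
Hypotheses (q0 : (0 < q)%R) (q1 : (q < 1)%R) (p1 : (1 < p)%R).

Let sfin k : sigma (Q k) < +oo. Proof. by case/andP: (sQ k). Qed.
Let wfin k : omega (Q k) < +oo. Proof. by case/andP: (wQ k). Qed.
Local Notation D := (atoms_of Q).
Local Notation s := (@weight _ _ R _ Q sigma).
Local Notation w := (@weight _ _ R _ Q omega).
Local Notation lamk := (fun k => lam (Q k)).
Local Notation th := ((p - 1) * q / (p - q))%R.

Let sP k : (0 < mass D s k)%R.
Proof. by rewrite -lte_fin mass_weight//; case/andP: (sQ k). Qed.
Let wP k : (0 < mass D w k)%R.
Proof. by rewrite -lte_fin mass_weight//; case/andP: (wQ k). Qed.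
Let DL : laminar D. Proof. exact: atoms_laminar. Qed.
Let pq0 : (0 < p - q)%R. Proof. by move: p1 q1; lra. Qed.
Let p0 : (0 < p)%R. Proof. by move: p1; lra. Qed.
Let p10 : (0 < p - 1)%R. Proof. by move: p1; lra. Qed.

Lemma sum_cubes_step (c : 'I_n -> R) x :
  (\sum_k c k * \1_(Q k) x)%R = step (fun i => \sum_(k | i \in D k) c k)%R x.
Proof.
have [[i ix]|Qx] := atoms_exhaust Q x; last first.
  by rewrite step_out// big1// => k _; rewrite indicE memNset ?mulr0.
rewrite (step_atom _ ix) [RHS]big_mkcond/=; apply: eq_bigr => k _.
rewrite indicE; case: ifPn => [/(atom_cube _ ix) Qx|iNk].
  by rewrite mem_set// mulr1.
by rewrite memNset ?mulr0// => Qx; move/negP: iNk; apply; apply/(atom_cube _ ix).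
Qed.

Lemma op_step (f : T -> R) (h : atom_index Q -> R) x :
  (forall k, \int[sigma]_(y in Q k) (f y)%:E = (mass D (fun i => s i * h i)%R k)%:E) ->
  \sum_k op_term sigma lam f x (Q k) = (step (disc_op D s lamk h) x)%:E.
Proof.
move=> fh; rewrite -sum_cubes_step -sumEFin; apply: eq_bigr => k _.
rewrite /op_term fh -(mass_weight mQ sfin) inver (gt_eqF (sP k)) -!EFinM.
by congr _%:E; rewrite /avg; ring.
Qed.

Lemma coef_step (a : set T -> R) x :
  \sum_k coef_term sigma omega lam p a x (Q k) =
  (step (disc_coef D s w lamk p (fun k => a (Q k))) x)%:E.
Proof.
rewrite -sum_cubes_step -sumEFin; apply: eq_bigr => k _.
rewrite /coef_term -(mass_weight mQ sfin) -(mass_weight mQ wfin).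
by rewrite inver (gt_eqF (sP k)) -(EFinM (mass D w k)) poweR_EFin -!EFinM.
Qed.

Lemma step_powR r (h : atom_index Q -> R) x : r != 0%R ->
  (step h x `^ r)%R = step (fun i => h i `^ r)%R x.
Proof.
move=> r0; have [[i ix]|Qx] := atoms_exhaust Q x.
  by rewrite !(step_atom _ ix).
by rewrite !step_out// powR0.
Qed.

Lemma integral_step_powR (mu : {measure set T -> \bar R}) r (h : atom_index Q -> R) :
  (forall k, mu (Q k) < +oo) -> r != 0%R ->
  \int[mu]_x ((step h x)%:E `^ r) = (\sum_i weight mu i * h i `^ r)%:E.
Proof.
move=> mufin r0; rewrite -integral_step_fin//; last by move=> i; exact: powR_ge0.
by apply: eq_integral => x _; rewrite poweR_EFin step_powR.
Qed.

Lemma integral_coef (a : set T -> R) :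
  \int[omega]_x (\sum_k coef_term sigma omega lam p a x (Q k)) `^ th =
  (\sum_i w i * disc_coef D s w lamk p (fun k => a (Q k)) i `^ th)%:E.
Proof.
under eq_integral do rewrite coef_step.
rewrite integral_step_powR// gt_eqF// divr_gt0// mulr_gt0//.
Qed.

Lemma sum_subcubes (b : 'I_n -> R) k :
  (\sum_(l | D l \subset D k) (b l)^-1 * mass D s l)%R =
  (\sum_(l | `[< Q l `<=` Q k >]) (b l)^-1 * fine (sigma (Q l)))%R.
Proof.
apply: eq_big => [l|l _]; last by rewrite -(mass_weight mQ sfin).
by apply/idP/idP => [/atoms_subset/asboolP|/asboolP/atoms_subset].
Qed.

(** Replacing f by its averages over the atoms keeps the averages over the sets Q k
    and, by Jensen's inequality, does not increase the norm of f. *)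
Lemma sufficiency_family (A : R) (a : set T -> R) (f : T -> R) : (0 < A)%R ->
  (forall k, 0 < a (Q k))%R ->
  (forall k, \sum_(l | `[< Q l `<=` Q k >]) (a (Q l))^-1 * fine (sigma (Q l))
     <= A * fine (sigma (Q k)))%R ->
  measurable_fun setT f -> (forall x, 0 <= f x)%R ->
  \int[sigma]_x (f x `^ p)%:E < +oo ->
  \int[omega]_x (\sum_k op_term sigma lam f x (Q k)) `^ q <=
  ((A * embedding_cst p)%:E * \int[sigma]_x (f x `^ p)%:E) `^ (q / p) *
  (\int[omega]_x (\sum_k coef_term sigma omega lam p a x (Q k)) `^ th)
    `^ ((p - q) / p).
Proof.
move=> A0 a0 ca mf f0 fp; pose h : atom_index Q -> R := cond_avg sigma f.
have h0 i : (0 <= h i)%R by exact: cond_avg_ge0.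
have hE := cond_avg_cube mQ sfin p1 mf f0 fp.
under eq_integral do rewrite (op_step _ hE).
rewrite integral_step_powR// ?gt_eqF// integral_coef.
have AC0 : (0 <= A * embedding_cst p)%R.
  by rewrite mulr_ge0 ?(ltW A0)// ltW// embedding_cst_gt0.
have fpE : \int[sigma]_x (f x `^ p)%:E = (fine (\int[sigma]_x (f x `^ p)%:E))%:E.
  rewrite fineK// ge0_fin_numE// integral_ge0// => x _; by rewrite lee_fin powR_ge0.
have sh0 : (0 <= \sum_i s i * h i `^ p)%R.
  by apply: sumr_ge0 => i _; rewrite mulr_ge0 ?powR_ge0 ?weight_ge0.
have jen := cond_avg_jensen mQ sfin p1 mf f0 fp.
rewrite fpE lee_fin in jen *.
rewrite -EFinM lee_fin.
have cak k : (\sum_(l | D l \subset D k) (a (Q l))^-1 * mass D s l <= A * mass D s k)%R.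
  by rewrite sum_subcubes (le_trans (ca k))// -(mass_weight mQ sfin).
have := finite_sufficiency (weight_ge0 sigma) (weight_ge0 omega) sP wP lamP q0 q1 p1
  DL A0 a0 cak h0.
move=> /le_trans; apply; apply: ler_wpM2r; first exact: powR_ge0.
apply: ge0_ler_powR; rewrite ?nnegrE.
- by rewrite divr_ge0 ?(ltW q0) ?(ltW p0).
- exact: mulr_ge0.
- by rewrite mulr_ge0// (le_trans sh0).
- exact: ler_wpM2l.
Qed.

(** Testing the norm inequality on functions that are constant on the atoms gives the
    hypothesis of [finite_necessity].  The conclusion is stated for every extension b of a to
    all sets, since the coefficients are eventually indexed by sets. *)
Lemma necessity_family (N : R) : (0 < N)%R ->
  (forall h : atom_index Q -> R, (forall i, 0 <= h i)%R ->
    \int[omega]_x (\sum_k op_term sigma lam (step h) x (Q k)) `^ q <=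
    (N `^ q)%:E * (\int[sigma]_x (step h x)%:E `^ p) `^ (q / p)) ->
  exists a : 'I_n -> R, [/\ forall k, (0 < a k)%R,
    forall k, (\sum_(l | `[< Q l `<=` Q k >]) (a l)^-1 * fine (sigma (Q l))
     <= fine (sigma (Q k)))%R &
    forall b : set T -> R, (forall k, b (Q k) = a k) ->
    \int[omega]_x (\sum_k coef_term sigma omega lam p b x (Q k)) `^ th
    <= (necessity_cst p q * N `^ (p * q / (p - q)))%:E].
Proof.
move=> N0 norm.
have [h h0|a [a0 ca Ba]] := finite_necessity q0 q1 p1 DL (atom_cover (Q := Q))
  (weight_ge0 sigma) (weight_ge0 omega) sP wP lamP N0.
  have := norm h h0.
  have hE k := integral_step_cube mQ sfin k h0.
  under eq_integral do rewrite (op_step _ hE).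
  by rewrite !integral_step_powR// ?gt_eqF// poweR_EFin -EFinM lee_fin.
exists a; split=> // [k|b ba].
  by have := ca k; rewrite sum_subcubes -[mass _ _ _]/(fine (mass D s k)%:E) (mass_weight mQ sfin).
rewrite integral_coef lee_fin; apply: le_trans Ba.
rewrite le_eqVlt; apply/orP; left; apply/eqP; apply: eq_bigr => i _.
congr (_ * (_ `^ _))%R; apply: eq_bigr => k _; by rewrite ba.
Qed.

End finite_family.

(** * Exhausting a countable family *)

Lemma le_poweR (R : realType) (r : R) (x y : \bar R) : (0 <= r)%R -> 0 <= x -> x <= y ->
  x `^ r <= y `^ r.
Proof.
move=> r0 x0 xy; apply: gt0_ler_poweR => //; rewrite in_itv/= leey andbT//.
exact: le_trans xy.
Qed.

(** A positive power is an increasing bijection of the nonnegative extended reals. *)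
Lemma ereal_sup_poweR (R : realType) (r : R) (u : (\bar R)^nat) : (0 < r)%R ->
  (forall n, 0 <= u n) ->
  ereal_sup (range u) `^ r = ereal_sup (range (fun n => u n `^ r)).
Proof.
move=> r0 u0; have s0 : 0 <= ereal_sup (range u).
  by apply: (le_trans (u0 0%N)); apply: ereal_sup_ubound; exists 0%N.
apply/eqP; rewrite eq_le; apply/andP; split; last first.
  apply: ge_ereal_sup => _ [n _ <-]; apply: le_poweR => //; first exact: ltW.
  by apply: ereal_sup_ubound; exists n.
set M := ereal_sup (range (fun n => u n `^ r)).
have uM n : u n `^ r <= M by apply: ereal_sup_ubound; exists n.
have M0 : 0 <= M by apply: le_trans (uM 0%N); exact: poweR_ge0.
rewrite -[leRHS](poweRe1 M0) -(mulVf (lt0r_neq0 r0)) poweRrM.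
apply: le_poweR => //; first exact: ltW.
apply: ge_ereal_sup => _ [n _ <-].
rewrite -[leLHS](poweRe1 (u0 n)) -(mulfV (lt0r_neq0 r0)) poweRrM.
by apply: le_poweR => //; [rewrite invr_ge0 ltW|exact: poweR_ge0].
Qed.

Lemma sum_le_esum (R : realType) (X : choiceType) (P : set X) (F : X -> \bar R)
    (L : seq X) : uniq L -> (forall x, x \in L -> P x) ->
  \sum_(x <- L) F x <= \esum_(x in P) F x.
Proof.
move=> uL LP; apply: ereal_sup_ubound; exists [set` L].
  by split; [exact: finite_seq|move=> x /= /LP].
by rewrite (fsbig_seq _ _ uL).
Qed.

Lemma lee_sum_subset (R : realType) (X : choiceType) (F : X -> \bar R) (s u : seq X) :
  uniq s -> uniq u -> {subset s <= u} -> (forall x, x \in u -> 0 <= F x) ->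
  \sum_(x <- s) F x <= \sum_(x <- u) F x.
Proof.
move=> us uu su F0; rewrite (fsbig_seq _ _ us) (fsbig_seq _ _ uu).
apply: lee_fsum_nneg_subset; [exact: finite_seq..| |].
  by move=> x; rewrite !inE; exact: su.
by move=> x; rewrite !inE => /andP[_]; rewrite inE; exact: F0.
Qed.

Lemma finite_set_uniq_seq (X : choiceType) (A : set X) : finite_set A ->
  exists2 s : seq X, uniq s & A = [set` s].
Proof.
move=> /finite_seqP[s As]; exists (undup s); first exact: undup_uniq.
by rewrite As; apply/seteqP; split => x /=; rewrite mem_undup.
Qed.

Section enumeration.
Context {X : choiceType} {R : realType}.
Variable e : nat -> X.

Definition first_values n : seq X := undup [seq e i | i <- iota 0 n].

Lemma first_values_uniq n : uniq (first_values n).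
Proof. exact: undup_uniq. Qed.

Lemma mem_first_values n x : reflect (exists2 i, (i < n)%N & e i = x) (x \in first_values n).
Proof.
rewrite mem_undup; apply: (iffP mapP) => [[i]|[i lin <-]].
  by rewrite mem_iota => /= lin ->; exists i.
by exists i => //; rewrite mem_iota.
Qed.

Lemma first_values_range n x : x \in first_values n -> range e x.
Proof. by move=> /mem_first_values[i _ <-]; exists i. Qed.

Lemma first_values_subset m n : (m <= n)%N ->
  {subset first_values m <= first_values n}.
Proof.
move=> mn x /mem_first_values[i im <-]; apply/mem_first_values; exists i => //.
exact: leq_trans mn.
Qed.

Lemma first_values_exhaust (L : seq X) : (forall x, x \in L -> range e x) ->
  exists n, {subset L <= first_values n}.
Proof.
elim: L => [|x L IH] LP; first by exists 0%N.
have [n Ln] : exists n, {subset L <= first_values n}.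
  by apply: IH => y yL; apply: LP; rewrite inE yL orbT.
have [i _ ix] := LP x (mem_head _ _).
exists (maxn n i.+1) => y; rewrite inE => /predU1P[->|/Ln].
  by apply/mem_first_values; exists i => //; rewrite leq_max ltnSn orbT.
by apply: first_values_subset; rewrite leq_maxl.
Qed.

Lemma esum_enum (F : X -> \bar R) : (forall x, range e x -> 0 <= F x) ->
  \esum_(x in range e) F x = ereal_sup (range (fun n => \sum_(x <- first_values n) F x)).
Proof.
move=> F0; apply/eqP; rewrite eq_le; apply/andP; split; last first.
  apply: ge_ereal_sup => _ [n _ <-]; apply: sum_le_esum.
    exact: first_values_uniq.
  by move=> x; exact: first_values_range.
apply: ge_ereal_sup => _ [A [finA Ae] <-].
have [s us As] := finite_set_uniq_seq finA.
have [n sn] : exists n, {subset s <= first_values n}.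
  by apply: first_values_exhaust => x xs; apply: Ae; rewrite As.
apply: (@le_trans _ _ (\sum_(x <- first_values n) F x)); last first.
  by apply: ereal_sup_ubound; exists n.
rewrite As -(fsbig_seq _ _ us); apply: lee_sum_subset => //.
  exact: first_values_uniq.
by move=> x xn; apply: F0; exact: first_values_range xn.
Qed.

Lemma sum_first_values_nd (F : X -> \bar R) : (forall x, range e x -> 0 <= F x) ->
  {homo (fun n => \sum_(x <- first_values n) F x) : m n / (m <= n)%N >-> m <= n}.
Proof.
move=> F0 m n mn; apply: lee_sum_subset; rewrite ?first_values_uniq//.
  exact: first_values_subset.
by move=> x xn; apply: F0; exact: first_values_range xn.
Qed.

(** Monotone convergence along the finite lists of first values, without repetition, of e.
    Both directions are used: the supremum bounds the integral, and each finite stage is bounded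
    by the integral. *)
Lemma integral_esum_powR d (T : measurableType d) (mu : {measure set T -> \bar R})
    (r : R) (F : T -> X -> \bar R) : (0 < r)%R ->
  (forall t x, range e x -> 0 <= F t x) ->
  (forall x, range e x -> measurable_fun setT (F ^~ x)) ->
  \int[mu]_t (\esum_(x in range e) F t x) `^ r =
  ereal_sup (range (fun n => \int[mu]_t (\sum_(x <- first_values n) F t x) `^ r)).
Proof.
move=> r0 F0 mF.
pose g n t := (\sum_(x <- first_values n) F t x) `^ r.
have s0 n t : 0 <= \sum_(x <- first_values n) F t x.
  by rewrite big_seq; apply: sume_ge0 => x xn; apply: F0; exact: first_values_range xn.
have nd t : {homo g ^~ t : m n / (m <= n)%N >-> m <= n}.
  move=> m n mn; apply: le_poweR => //; [exact: ltW|exact: (sum_first_values_nd (F0 t))].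
have mg n : measurable_fun setT (g n).
  apply: (measurableT_comp (measurable_poweR _)).
  rewrite (_ : (fun t => _) = fun t =>
    \sum_(x <- first_values n) (if x \in first_values n then F t x else 0)).
    apply: emeasurable_sum => x; have [xn|_] := boolP (x \in _); last exact: measurable_cst.
    by apply: mF; exact: first_values_range xn.
  apply/funext => t; rewrite big_seq_cond [RHS]big_seq_cond.
  by apply: eq_bigr => x; rewrite andbT => ->.
have g0 n t : setT t -> 0 <= g n t by move=> _; exact: poweR_ge0.
have := monotone_convergence mu measurableT mg g0 (fun t _ => nd t).
have -> : limn (fun n => \int[mu]_t g n t) = ereal_sup (range (fun n => \int[mu]_t g n t)).
  apply/cvg_lim => //; apply: ereal_nondecreasing_cvgn => m n mn.
  apply: ge0_le_integral; [exact: measurableT|exact: g0|exact: mg|exact: mg|].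
  by move=> t _; exact: (nd t _ _ mn).
move=> <-; apply: eq_integral => t _; rewrite (esum_enum (F0 t)).
rewrite ereal_sup_poweR//; apply/esym/cvg_lim => //.
exact: ereal_nondecreasing_cvgn.
Qed.

End enumeration.

(** * Countable laminar families *)

Section countable_family.
Context {d : measure_display} {T : measurableType d} {R : realType}.
Variable e : nat -> set T.
Variables sigma omega : {measure set T -> \bar R}.
Variable lam : set T -> R.
Variables (p q : R).
Hypotheses (q0 : (0 < q)%R) (q1 : (q < 1)%R) (p1 : (1 < p)%R).
Local Notation QQ := (range e).
Hypothesis mQ : forall Q, QQ Q -> measurable Q.
Hypothesis lamQ : forall Q S, QQ Q -> QQ S ->
  Q `<=` S \/ S `<=` Q \/ Q `&` S = set0.
Hypothesis sQ : forall Q, QQ Q -> 0 < sigma Q < +oo.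
Hypothesis wQ : forall Q, QQ Q -> 0 < omega Q < +oo.
Hypothesis lamP : forall Q, QQ Q -> (0 < lam Q)%R.
Local Notation L := (first_values e).
Local Notation th := ((p - 1) * q / (p - q))%R.
Local Notation r := (conj_exp p).

Let pq0 : (0 < p - q)%R. Proof. by move: p1 q1; lra. Qed.
Let p0 : (0 < p)%R. Proof. by move: p1; lra. Qed.
Let p10 : (0 < p - 1)%R. Proof. by move: p1; lra. Qed.
Let th0 : (0 < th)%R. Proof. by rewrite divr_gt0// mulr_gt0. Qed.

Let fam n (k : 'I_(size (L n))) : set T := tnth (in_tuple (L n)) k.

Let famP n k : @fam n k \in L n. Proof. exact: mem_tnth. Qed.
Let famR n k : QQ (@fam n k). Proof. exact: first_values_range (famP k). Qed.

Let famE n Q : Q \in L n -> exists k, @fam n k = Q.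
Proof. by move=> /(@tnthP _ _ (in_tuple (L n)))[k ->]; exists k. Qed.

Let sum_fam n (F : set T -> \bar R) : \sum_(Q <- L n) F Q = \sum_k F (@fam n k).
Proof. by rewrite big_tnth. Qed.

Let sum_fam_real n (P : pred (set T)) (F : set T -> R) :
  (\sum_(Q <- L n | P Q) F Q = \sum_(k | P (@fam n k)) F (@fam n k))%R.
Proof. by rewrite big_tnth. Qed.

Let op_term_ge0 f x Q : QQ Q -> (forall x, 0 <= f x)%R -> 0 <= op_term sigma lam f x Q.
Proof.
move=> QQQ f0; rewrite !mule_ge0// ?lee_fin ?(ltW (lamP QQQ))//.
- by rewrite inve_ge0.
- by apply: integral_ge0 => y _; rewrite lee_fin.
Qed.

Let coef_term_ge0 a x Q : 0 <= coef_term sigma omega lam p a x Q.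
Proof. by rewrite !mule_ge0 ?poweR_ge0// lee_fin powR_ge0. Qed.

Let measurable_op f Q : QQ Q -> measurable_fun setT (fun x => op_term sigma lam f x Q).
Proof.
move=> /mQ mQQ; apply: measurable_funeM; apply/measurable_EFinP.
exact: measurable_indic.
Qed.

Let measurable_coef a Q : QQ Q ->
  measurable_fun setT (fun x => coef_term sigma omega lam p a x Q).
Proof.
move=> /mQ mQQ; apply: measurable_funeM; apply/measurable_EFinP.
exact: measurable_indic.
Qed.

Lemma integral_esum_op (f : T -> R) : (forall x, 0 <= f x)%R ->
  \int[omega]_x (\esum_(Q in QQ) op_term sigma lam f x Q) `^ q =
  ereal_sup (range (fun n =>
    \int[omega]_x (\sum_(Q <- L n) op_term sigma lam f x Q) `^ q)).
Proof.
move=> f0; apply: integral_esum_powR => // [x Q QQQ|Q]; first exact: op_term_ge0.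
exact: measurable_op.
Qed.

Lemma integral_esum_coef a :
  \int[omega]_x (\esum_(Q in QQ) coef_term sigma omega lam p a x Q) `^ th =
  ereal_sup (range (fun n =>
    \int[omega]_x (\sum_(Q <- L n) coef_term sigma omega lam p a x Q) `^ th)).
Proof. by apply: integral_esum_powR => // Q; exact: measurable_coef. Qed.

Lemma fin_sigma Q : QQ Q -> (fine (sigma Q))%:E = sigma Q.
Proof. by move=> /sQ/andP[s0 sy]; rewrite fineK// ge0_fin_numE// ltW. Qed.

Lemma fin_omega Q : QQ Q -> (fine (omega Q))%:E = omega Q.
Proof. by move=> /wQ/andP[s0 sy]; rewrite fineK// ge0_fin_numE// ltW. Qed.

Let fine_sigma_gt0 Q : QQ Q -> (0 < fine (sigma Q))%R.
Proof. by move=> QQQ; rewrite -lte_fin fin_sigma//; case/andP: (sQ QQQ). Qed.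

Let fine_omega_gt0 Q : QQ Q -> (0 < fine (omega Q))%R.
Proof. by move=> QQQ; rewrite -lte_fin fin_omega//; case/andP: (wQ QQQ). Qed.

Lemma countable_sufficiency (A : R) (a : set T -> R) (f : T -> R) : (0 < A)%R ->
  (forall Q, QQ Q -> 0 < a Q)%R ->
  (forall Q, QQ Q ->
    \esum_(S in QQ `&` [set S | S `<=` Q]) (((a S)^-1)%:E * sigma S)
      <= A%:E * sigma Q) ->
  measurable_fun setT f -> (forall x, 0 <= f x)%R ->
  \int[sigma]_x (f x `^ p)%:E < +oo ->
  \int[omega]_x (\esum_(Q in QQ) op_term sigma lam f x Q) `^ q <=
  ((A * embedding_cst p)%:E * \int[sigma]_x (f x `^ p)%:E) `^ (q / p) *
  (\int[omega]_x (\esum_(Q in QQ) coef_term sigma omega lam p a x Q) `^ th)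
    `^ ((p - q) / p).
Proof.
move=> A0 a0 ca mf f0 fp; rewrite integral_esum_op//.
apply: ge_ereal_sup => _ [n _ <-].
have lamF (k l : 'I_(size (L n))) :
    @fam n k `<=` fam l \/ fam l `<=` fam k \/ fam k `&` fam l = set0.
  by apply: lamQ; exact: famR.
have caF (k : 'I_(size (L n))) :
    (\sum_(l | `[< @fam n l `<=` fam k >]) (a (fam l))^-1 * fine (sigma (fam l))
     <= A * fine (sigma (fam k)))%R.
  rewrite -lee_fin EFinM (fin_sigma (famR k)).
  apply: le_trans (ca _ (famR k)).
  rewrite -(sum_fam_real n (fun S => `[< S `<=` fam k >]) (fun S => (a S)^-1 * fine (sigma S))%R).
  rewrite -sumEFin -big_filter.
  rewrite (eq_big_seq (fun S => ((a S)^-1)%:E * sigma S)); last first.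
    move=> S; rewrite mem_filter => /andP[_ /first_values_range SQ].
    by rewrite EFinM fin_sigma.
  apply: sum_le_esum; first by rewrite filter_uniq// first_values_uniq.
  move=> S; rewrite mem_filter => /andP[/asboolP SQ /first_values_range QS]; by split.
under eq_integral do rewrite sum_fam.
have := sufficiency_family (fun k => mQ (famR k)) lamF (fun k => sQ (famR k))
  (fun k => wQ (famR k)) (fun k => lamP (famR k)) q0 q1 p1 A0 (fun k => a0 _ (famR k)) caF mf f0 fp.
move=> /le_trans; apply; apply: lee_wpmul2l; first exact: poweR_ge0.
apply: le_poweR; first by rewrite divr_ge0 ?(ltW pq0) ?(ltW p0).
  by apply: integral_ge0 => x _; exact: poweR_ge0.
rewrite integral_esum_coef; apply: ereal_sup_ubound; exists n => //.
by apply: eq_integral => x _; rewrite sum_fam.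
Qed.

Definition coef_value a Q : R :=
  (lam Q `^ r * (fine (omega Q) / fine (sigma Q)) `^ (r - 1) * a Q `^ (r - 1))%R.

Lemma coef_termE a x Q : QQ Q ->
  coef_term sigma omega lam p a x Q = (coef_value a Q * \1_Q x)%:E.
Proof.
move=> QQQ; rewrite /coef_term -(fin_sigma QQQ) -(fin_omega QQQ) inver.
by rewrite (gt_eqF (fine_sigma_gt0 QQQ)) -(EFinM (fine (omega Q))) poweR_EFin -!EFinM.
Qed.

Lemma coef_value_ge0 a Q : (0 <= coef_value a Q)%R.
Proof. by rewrite !mulr_ge0 ?powR_ge0. Qed.

Let measurable_level n a : measurable_fun setT
  (fun x => (\sum_(S <- L n) coef_term sigma omega lam p a x S) `^ th).
Proof.
apply: (measurableT_comp (measurable_poweR _)).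
rewrite (_ : (fun t => _) = fun t => \sum_k coef_term sigma omega lam p a t (@fam n k)); last first.
  by apply/funext => x; rewrite sum_fam.
by apply: emeasurable_sum => k; apply: measurable_coef; exact: famR.
Qed.

(** A single cube bounds the integral from below.  This is what bounds a_Q from above, and
    what keeps the operator norm away from 0. *)
Lemma coef_lower_bound n a Q : Q \in L n ->
  (coef_value a Q `^ th * fine (omega Q))%:E <=
  \int[omega]_x (\sum_(S <- L n) coef_term sigma omega lam p a x S) `^ th.
Proof.
move=> Qn; have QQQ := first_values_range Qn.
have mI : measurable_fun setT (fun x => (\1_Q x : R)%:E).
  by apply/measurable_EFinP; apply: measurable_indic; exact: mQ.
rewrite EFinM fin_omega//.
have -> : omega Q = \int[omega]_x (\1_Q x)%:E by rewrite integral_indic ?setIT//; exact: mQ.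
rewrite -ge0_integralZl_EFin ?powR_ge0//.
apply: ge0_le_integral => //.
- by move=> x _; rewrite -EFinM lee_fin mulr_ge0// powR_ge0.
- exact: measurable_funeM.
move=> x _; rewrite indicE; case: (boolP (x \in Q)) => [xQ|_]; last by rewrite mule0 poweR_ge0.
rewrite mule1 -poweR_EFin; apply: le_poweR; rewrite ?lee_fin ?coef_value_ge0 ?(ltW th0)//.
rewrite (bigD1_seq Q)//= ?first_values_uniq// coef_termE// indicE xQ mulr1.
by rewrite leeDl// sume_ge0.
Qed.

(** In the packing condition at Q, the term S = Q alone forces a_Q >= 1. *)
Lemma one_le_coef (a : set T -> R) Q (s : seq (set T)) : QQ Q -> (0 < a Q)%R -> Q \in s ->
  (forall S, S \in s -> QQ S /\ (0 < a S)%R) ->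
  (\sum_(S <- s | `[< S `<=` Q >]) (a S)^-1 * fine (sigma S) <= fine (sigma Q))%R ->
  (1 <= a Q)%R.
Proof.
move=> QQQ aQ Qs sP ca; rewrite -invf_le1// -(ler_pM2r (fine_sigma_gt0 QQQ)) mul1r.
apply: le_trans ca; rewrite (big_rem Q Qs)/= asboolT// lerDl big_seq_cond.
apply: sumr_ge0 => S /andP[/mem_rem/sP[QS aS] _].
by rewrite mulr_ge0 ?invr_ge0 ?(ltW aS)// ltW// fine_sigma_gt0.
Qed.

Section necessity.
Variable N : R.
Hypothesis N0 : (0 < N)%R.
Hypothesis normN : forall f : T -> R, measurable_fun setT f ->
  (forall x, 0 <= f x)%R -> \int[sigma]_x (f x `^ p)%:E < +oo ->
  \int[omega]_x (\esum_(Q in QQ) op_term sigma lam f x Q) `^ q <=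
  (N `^ q)%:E * (\int[sigma]_x (f x `^ p)%:E) `^ (q / p).
Local Notation t := (p * q / (p - q))%R.

Lemma necessity_level n : exists a : set T -> R,
  [/\ forall Q, Q \in L n -> (0 < a Q)%R,
    forall Q, Q \in L n ->
      (\sum_(S <- L n | `[< S `<=` Q >]) (a S)^-1 * fine (sigma S)
        <= fine (sigma Q))%R &
    \int[omega]_x (\sum_(Q <- L n) coef_term sigma omega lam p a x Q) `^ th
      <= (necessity_cst p q * N `^ t)%:E].
Proof.
have lamF (k l : 'I_(size (L n))) :
    @fam n k `<=` fam l \/ fam l `<=` fam k \/ fam k `&` fam l = set0.
  by apply: lamQ; exact: famR.
have [h h0|a [a0 ca Ba]] := necessity_family (fun k => mQ (@famR n k)) lamF
  (fun k => sQ (famR k)) (fun k => wQ (famR k)) (fun k => lamP (famR k)) q0 q1 p1 N0.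
  have mh := measurable_step (fun k => mQ (@famR n k)) h.
  have hp : \int[sigma]_x (step h x `^ p)%:E = \int[sigma]_x (step h x)%:E `^ p.
    by apply: eq_integral => x _; rewrite poweR_EFin.
  have hp0 : \int[sigma]_x (step h x `^ p)%:E < +oo.
    rewrite hp integral_step_powR ?ltry//.
    - by move=> k; exact: mQ.
    - by move=> k; case/andP: (sQ (famR k)).
    - by rewrite gt_eqF.
  have h0' x : (0 <= step h x)%R by exact: step_ge0.
  have := normN mh h0' hp0; rewrite hp; apply: le_trans.
  rewrite integral_esum_op//; apply: ereal_sup_ubound; exists n => //.
  by apply: eq_integral => x _; rewrite sum_fam.
(* Coefficients on the list, extended by an arbitrary value to all sets. *)
pose b Q : R := if insub (index Q (L n)) is Some k then a k else 1%R.
have bE k : b (fam k) = a k.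
  rewrite /b /fam (tnth_nth set0) index_uniq ?first_values_uniq//.
  by rewrite valK.
exists b; split.
- by move=> _ /famE[k <-]; rewrite bE.
- move=> _ /famE[k <-]; rewrite sum_fam_real; apply: le_trans (ca k).
  by rewrite le_eqVlt; apply/orP; left; apply/eqP; apply: eq_bigr => l _; rewrite bE.
- apply: le_trans (Ba b bE); rewrite le_eqVlt; apply/orP; left; apply/eqP.
  by apply: eq_integral => x _; rewrite sum_fam.
Qed.

Local Notation M := (necessity_cst p q * N `^ t)%R.

Let rB0 : (0 < r - 1)%R. Proof. by rewrite subr_gt0 conj_exp_gt1. Qed.

Let coef_value_split (a : set T -> R) Q :
  coef_value a Q = (coef_value (fun=> 1%R) Q * a Q `^ (r - 1))%R.
Proof. by rewrite /coef_value powR1 mulr1. Qed.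

Let coef_value1_gt0 Q : QQ Q -> (0 < coef_value (fun=> 1%R) Q)%R.
Proof.
move=> QQQ; rewrite /coef_value powR1 mulr1 mulr_gt0 ?powR_gt0 ?lamP//.
by rewrite divr_gt0 ?fine_sigma_gt0 ?fine_omega_gt0.
Qed.

(** Limit of the coefficients found for the first n cubes.  The factor 2 in the
    comparison with the limit is responsible for the packing constant 2 and for the power of 2
    in the integral bound. *)
Lemma countable_necessity : exists a : set T -> R,
  [/\ forall Q, QQ Q -> (1 <= a Q)%R,
    forall Q, QQ Q ->
    \esum_(S in QQ `&` [set S | S `<=` Q]) (((a S)^-1)%:E * sigma S)
      <= 2%:E * sigma Q &
    \int[omega]_x (\esum_(Q in QQ) coef_term sigma omega lam p a x Q) `^ th
      <= (2 `^ ((r - 1) * th) * M)%:E].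
Proof.
have [x xP] := boolp.choice necessity_level.
have x0 n Q : Q \in L n -> (0 < x n Q)%R by case: (xP n) => + _ _; apply.
have xC n Q : Q \in L n -> (\sum_(S <- L n | `[< S `<=` Q >]) (x n S)^-1 * fine (sigma S)
    <= fine (sigma Q))%R by case: (xP n) => _ + _; apply.
have xM n : \int[omega]_y (\sum_(Q <- L n) coef_term sigma omega lam p (x n) y Q) `^ th <= M%:E.
  by case: (xP n).
have x1 n Q : Q \in L n -> (1 <= x n Q)%R.
  move=> Qn; apply: (one_le_coef _ _ Qn _ (xC _ _ Qn)).
  - exact: first_values_range Qn.
  - exact: x0.
  - by move=> S Sn; split; [exact: first_values_range Sn|exact: x0].
have mem_level Q : QQ Q -> exists m, forall n, (m <= n)%N -> Q \in L n.
  by case=> i _ <-; exists i.+1 => n im; apply/mem_first_values; exists i.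
have kap0 : (0 < (r - 1) * th)%R by rewrite mulr_gt0.
have xbound Q : QQ Q -> exists K m, forall n, (m <= n)%N -> (1 <= x n Q <= K)%R.
  move=> QQQ; have [m Qm] := mem_level Q QQQ.
  set c1 := coef_value (fun=> 1%R) Q.
  have c10 : (0 < c1)%R by exact: coef_value1_gt0.
  have cw0 : (0 < c1 `^ th * fine (omega Q))%R by rewrite mulr_gt0 ?powR_gt0 ?fine_omega_gt0.
  exists ((M / (c1 `^ th * fine (omega Q))) `^ ((r - 1) * th)^-1)%R, m => n /Qm Qn.
  rewrite x1//=; have xn0 := ltW (x0 _ _ Qn).
  have := le_trans (coef_lower_bound (x n) Qn) (xM n).
  rewrite lee_fin coef_value_split -/c1 powRM ?powR_ge0 ?(ltW c10)// -powRrM mulrAC.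
  rewrite mulrC -ler_pdivlMr// => h.
  have kV0 : (0 <= ((r - 1) * th)^-1)%R by rewrite invr_ge0 ltW.
  have xE : x n Q = ((x n Q `^ ((r - 1) * th)) `^ ((r - 1) * th)^-1)%R.
    by rewrite -powRrM mulfV ?lt0r_neq0// powRr1.
  rewrite [leLHS]xE; by apply: ge0_ler_powR; rewrite ?nnegrE ?powR_ge0// (le_trans _ h)// powR_ge0.
have [a [a1 ax]] := pointwise_limit_coefficients xbound.
have a0 Q : QQ Q -> (0 < a Q)%R by move=> /a1; exact: lt_le_trans.
exists a; split=> // [Q QQQ|].
  apply: ge_ereal_sup => _ [A [finA AQ] <-].
  have [s us As] := finite_set_uniq_seq finA.
  have sQQ S : S \in s -> QQ S /\ S `<=` Q by move=> Ss; apply: AQ; rewrite As.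
  have QsP S : S \in Q :: s -> QQ S by rewrite inE => /predU1P[->//|/sQQ[]].
  have [m Lm] := first_values_exhaust QsP.
  have [n [mn nax]] := ax _ m QsP.
  have Ln S : S \in Q :: s -> S \in L n by move=> /Lm; exact: first_values_subset.
  rewrite As -(fsbig_seq _ _ us).
  apply: (@le_trans _ _ (\sum_(S <- s) (2 * ((x n S)^-1 * fine (sigma S)))%:E)).
    rewrite big_seq [leRHS]big_seq; apply: lee_sum => S Ss; have [SQ _] := sQQ S Ss.
    rewrite -(fin_sigma SQ) -EFinM lee_fin mulrA; apply: ler_wpM2r.
      by rewrite ltW// fine_sigma_gt0.
    have SQs : S \in Q :: s by rewrite inE Ss orbT.
    have /andP[_ h] := nax S SQs.
    have xS0 := x0 _ _ (Ln _ SQs).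
    have -> : (2 * (x n S)^-1 = (x n S / 2)^-1)%R by rewrite invfM invrK mulrC.
    have SQa : (0 < a S)%R by exact: a0.
    by rewrite lef_pV2 ?posrE ?divr_gt0// ler_pdivrMr// mulrC.
  rewrite sumEFin -mulr_sumr -(fin_sigma QQQ) -EFinM lee_fin ler_pM2l//.
  apply: le_trans (xC n Q (Ln _ (mem_head _ _))).
  rewrite -[leRHS]big_filter -lee_fin -!sumEFin; apply: lee_sum_subset => //.
  - by rewrite filter_uniq// first_values_uniq.
  - move=> S Ss; rewrite mem_filter Ln ?inE ?Ss ?orbT// andbT; apply/asboolP.
    by case: (sQQ S Ss).
  - move=> S; rewrite mem_filter => /andP[_ Sn]; rewrite lee_fin mulr_ge0//.
    by rewrite invr_ge0 ltW// x0.
rewrite integral_esum_coef; apply: ge_ereal_sup => _ [m _ <-].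
have [n [mn nax]] := ax _ m (@first_values_range _ e m).
apply: (@le_trans _ _ (\int[omega]_y ((2 `^ ((r - 1) * th))%:E *
    (\sum_(Q <- L n) coef_term sigma omega lam p (x n) y Q) `^ th))); last first.
  rewrite ge0_integralZl_EFin ?powR_ge0//; last by move=> y _; exact: poweR_ge0.
  by rewrite EFinM lee_wpmul2l// lee_fin powR_ge0.
apply: ge0_le_integral => //; [by move=> y _; exact: poweR_ge0|exact: measurable_funeM|].
move=> y _; rewrite powRrM -poweR_EFin -poweRM ?lee_fin ?powR_ge0//; last exact: sume_ge0.
apply: le_poweR; [exact: ltW|exact: sume_ge0|].
apply: (@le_trans _ _ ((2 `^ (r - 1))%:E *
    \sum_(Q <- L m) coef_term sigma omega lam p (x n) y Q)); last first.
  apply: lee_wpmul2l; first by rewrite lee_fin powR_ge0.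
  by apply: lee_sum_subset; rewrite ?first_values_uniq//; exact: first_values_subset.
rewrite ge0_sume_distrr// big_seq [leRHS]big_seq; apply: lee_sum => Q Qm.
have QQQ := first_values_range Qm.
rewrite !coef_termE// -EFinM lee_fin mulrA; apply: ler_wpM2r => //.
rewrite coef_value_split (coef_value_split (x n)) mulrCA; apply: ler_wpM2l.
  exact: coef_value_ge0.
have aQ := ltW (a0 _ QQQ).
have /andP[h _] := nax Q Qm.
have xQ : (0 <= x n Q)%R by apply: le_trans h; exact: divr_ge0.
rewrite -powRM//; apply: ge0_ler_powR; rewrite ?nnegrE ?(ltW rB0) ?mulr_ge0//.
by rewrite mulrC -ler_pdivrMr.
Qed.

End necessity.
End countable_family.

(** * The two estimates for dyadic cubes *)

(** Dyadic cubes are indexed by a countable type; the member Q0 is the value at the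
    indices that give no cube of A. *)
Lemma dyadic_enumeration (R : realType) (d : nat) (A : set (set 'rV[R]_d)) :
  A `<=` @dyadic R d -> A !=set0 -> exists e : nat -> set 'rV[R]_d, A = range e.
Proof.
move=> Ad [Q0 AQ0].
pose cube (z : int * {ffun 'I_d -> int}) : set 'rV[R]_d := dyadic_cube z.1 z.2.
pose e n := if unpickle n is Some z then
  if `[< A (cube z) >] then cube z else Q0 else Q0.
exists e; apply/seteqP; split => [Q AQ|_ [n _ <-]]; last first.
  by rewrite /e; case: unpickle => [z|//]; case: asboolP.
have [k [j QE]] := Ad Q AQ.
exists (pickle (k, [ffun i => j i])) => //; rewrite /e pickleK.
have -> : cube (k, [ffun i => j i]) = Q.
  by rewrite QE /cube/=; congr dyadic_cube; apply/funext => i; rewrite ffunE.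
by rewrite asboolT.
Qed.

Section norms.
Context {d : measure_display} {T : measurableType d} {R : realType}.
Variable mu : {measure set T -> \bar R}.

Lemma ge0_Lnorm (r : R) (f : T -> \bar R) : (forall x, 0 <= f x) ->
  'N[mu]_r%:E[f] = (\int[mu]_x f x `^ r) `^ r^-1.
Proof.
by move=> f0; rewrite unlock; congr (_ `^ _); apply: eq_integral => x _; rewrite gee0_abs.
Qed.

Lemma ge0_Lnorm_EFin (r : R) (f : T -> R) : (forall x, 0 <= f x)%R ->
  'N[mu]_r%:E[EFin \o f] = (\int[mu]_x (f x `^ r)%:E) `^ r^-1.
Proof.
move=> f0; rewrite ge0_Lnorm => [|x]; last by rewrite lee_fin.
by congr (_ `^ _); apply: eq_integral => x _; rewrite poweR_EFin.
Qed.

Lemma ge0_LfunP (r : R) (f : T -> R) : (0 < r)%R -> (forall x, 0 <= f x)%R ->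
  f \in Lfun mu r%:E <->
  measurable_fun setT f /\ \int[mu]_x (f x `^ r)%:E < +oo.
Proof.
move=> r0 f0; have rV0 : (r^-1 != 0)%R by rewrite invr_eq0 gt_eqF.
split=> [|[mf fy]].
  case/andP; rewrite !inE/= /finite_norm ge0_Lnorm_EFin// => mf fy.
  by split=> //; exact: lty_poweRy fy.
apply/andP; split; first by rewrite inE.
by rewrite inE/= /finite_norm ge0_Lnorm_EFin//; exact: poweR_lty.
Qed.

End norms.

Section constants.
Context {R : realType}.
Variables (p q : R).
Hypotheses (q0 : (0 < q)%R) (q1 : (q < 1)%R) (p1 : (1 < p)%R).

Lemma necessity_cst_gt0 : (0 < necessity_cst p q)%R.
Proof.
have c2 : (0 < embedding_cst 2 :> R)%R by apply: embedding_cst_gt0; lra.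
have cr := embedding_cst_gt0 (conj_exp_gt1 p1).
apply: mulr_gt0; apply: powR_gt0; first exact: mulr_gt0.
by apply/powR_gt0/mulr_gt0 => //; exact: powR_gt0.
Qed.

Definition limit_cst : R :=
  (2 `^ ((conj_exp p - 1) * ((p - 1) * q / (p - q))) * necessity_cst p q)%R.

Lemma limit_cst_gt0 : (0 < limit_cst)%R.
Proof. by rewrite mulr_gt0 ?powR_gt0 ?necessity_cst_gt0. Qed.

Definition reverse_cst : R :=
  (2 * 2 `^ p^-1 * limit_cst `^ ((p - q) / (p * q)))%R.

Lemma reverse_cst_gt0 : (0 < reverse_cst)%R.
Proof. by rewrite !mulr_gt0 ?powR_gt0 ?limit_cst_gt0. Qed.

End constants.

Section charged.
Context {R : realType} {d : nat}.
Variables sigma omega : {measure set (borel_space R d) -> \bar R}.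
Variable lam : set 'rV[R]_d -> R.
Hypotheses (lfs : locally_finite sigma) (lfw : locally_finite omega).
Variables (p q : R).
Hypotheses (q0 : (0 < q)%R) (q1 : (q < 1)%R) (p1 : (1 < p)%R).
Local Notation QQ := (charged_cubes lam sigma omega).
Local Notation th := ((p - 1) * q / (p - q))%R.
Local Notation opnorm := (dyadic_op_norm lam sigma omega p q).

Let pq0 : (0 < p - q)%R. Proof. by move: p1 q1; lra. Qed.
Let p0 : (0 < p)%R. Proof. by move: p1; lra. Qed.
Let p10 : (0 < p - 1)%R. Proof. by move: p1; lra. Qed.
Let th0 : (0 < th)%R. Proof. by rewrite divr_gt0// mulr_gt0. Qed.

Let mQ Q : QQ Q -> measurable (Q : set (borel_space R d)).
Proof. by case=> dQ _ _ _; exact: measurable_dyadic. Qed.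

Let lamQ Q S : QQ Q -> QQ S -> Q `<=` S \/ S `<=` Q \/ Q `&` S = set0.
Proof. by case=> dQ _ _ _ [dS _ _ _]; exact: dyadic_laminar. Qed.

Let sQ Q : QQ Q -> 0 < sigma Q < +oo.
Proof. by case=> dQ _ -> _ /=; exact: dyadic_lty. Qed.

Let wQ Q : QQ Q -> 0 < omega Q < +oo.
Proof. by case=> dQ _ _ -> /=; exact: dyadic_lty. Qed.

Let lamP Q : QQ Q -> (0 < lam Q)%R. Proof. by case. Qed.

Lemma dyadic_op_ge0 (f : borel_space R d -> R) x : (forall x, 0 <= f x)%R ->
  0 <= dyadic_op lam sigma omega f x.
Proof.
move=> f0; apply: esum_ge0 => Q QQQ; rewrite !mule_ge0//.
- by rewrite lee_fin ltW// lamP.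
- by rewrite inve_ge0.
- by apply: integral_ge0 => y _; rewrite lee_fin.
Qed.

Lemma coef_integral_ge0 a : 0 <= coef_integral lam sigma omega p q a.
Proof. by apply: integral_ge0 => x _; exact: poweR_ge0. Qed.

Lemma carleson_const_ge0 a : 0 <= carleson_const lam sigma omega a.
Proof. by apply: ereal_sup_ubound; left. Qed.

Lemma coef_bound_ge0 a : 0 <= coef_bound lam sigma omega p q a.
Proof. by rewrite mule_ge0 ?poweR_ge0. Qed.

Lemma dyadic_op_norm_ge0 : 0 <= opnorm.
Proof. by apply: le_ereal_inf_tmp => C []. Qed.

Lemma dyadic_op_norm0 : QQ = set0 -> opnorm = 0.
Proof.
move=> QQ0; apply/eqP; rewrite eq_le dyadic_op_norm_ge0 andbT.
apply: ereal_inf_lbound; split=> // f _ f0; rewrite mul0e ge0_Lnorm//; last first.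
  by move=> x; exact: dyadic_op_ge0.
rewrite (eq_integral (cst 0)) => [|x _]; last first.
  by rewrite /dyadic_op QQ0 esum_set0 poweR0r// gt_eqF.
by rewrite integral0 poweR0r// invr_eq0 gt_eqF.
Qed.

Lemma coef_bound0 a : QQ = set0 -> coef_bound lam sigma omega p q a = 0.
Proof.
move=> QQ0; rewrite /coef_bound [coef_integral _ _ _ _ _ _](_ : _ = 0).
  by rewrite poweR0r ?mule0// gt_eqF// divr_gt0// mulr_gt0.
rewrite /coef_integral (eq_integral (cst 0)) ?integral0// => x _.
by rewrite QQ0 esum_set0 poweR0r// gt_eqF.
Qed.

(** The supremum that defines the constant, freed from the division by sigma(Q). *)
Lemma carleson_const_bound a Q : QQ Q ->
  \esum_(S in QQ `&` [set S | S `<=` Q]) (((a S)^-1)%:E * sigma S)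
    <= carleson_const lam sigma omega a * sigma Q.
Proof.
move=> QQQ; have /andP[sQ0 sQy] := sQ QQQ.
have sQf : sigma Q \is a fin_num by rewrite ge0_fin_numE// ltW.
have : (sigma Q)^-1 * (\esum_(S in QQ `&` [set S | S `<=` Q]) (((a S)^-1)%:E * sigma S))
    <= carleson_const lam sigma omega a.
  by apply: ereal_sup_ubound; right; exists Q.
rewrite -(fineK sQf) inver; have s0 : (0 < fine (sigma Q))%R by rewrite fine_gt0// sQ0.
by rewrite (gt_eqF s0) lee_pdivrMl// muleC.
Qed.

Lemma carleson_const_gt0 a Q : QQ Q -> (forall S, QQ S -> 0 < a S)%R ->
  0 < carleson_const lam sigma omega a.
Proof.
move=> QQQ a0; have /andP[sQ0 sQy] := sQ QQQ.
have : 0 < carleson_const lam sigma omega a * sigma Q.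
  apply: lt_le_trans (carleson_const_bound a QQQ).
  apply: (@lt_le_trans _ _ (((a Q)^-1)%:E * sigma Q)).
    by rewrite mule_gt0// lte_fin invr_gt0 a0.
  have := @sum_le_esum R (set 'rV[R]_d) (QQ `&` [set S | S `<=` Q])
    (fun S => ((a S)^-1)%:E * sigma S) [:: Q] isT.
  by rewrite big_seq1; apply => S; rewrite inE => /eqP ->; split.
by rewrite pmule_lgt0.
Qed.

Section nonempty.
Variables (e : nat -> set (borel_space R d)) (Q0 : set 'rV[R]_d).
Hypotheses (QE : QQ = range e) (QQ0 : QQ Q0).

Let mQe Q : range e Q -> measurable Q. Proof. by rewrite -QE; exact: mQ. Qed.
Let lamQe Q S : range e Q -> range e S -> Q `<=` S \/ S `<=` Q \/ Q `&` S = set0.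
Proof. by rewrite -QE; exact: lamQ. Qed.
Let sQe Q : range e Q -> 0 < sigma Q < +oo. Proof. by rewrite -QE; exact: sQ. Qed.
Let wQe Q : range e Q -> 0 < omega Q < +oo. Proof. by rewrite -QE; exact: wQ. Qed.
Let lamPe Q : range e Q -> (0 < lam Q)%R. Proof. by rewrite -QE; exact: lamP. Qed.

Let opE f x : dyadic_op lam sigma omega f x = \esum_(Q in range e) op_term sigma lam f x Q.
Proof. by rewrite -QE. Qed.

Let coefE a : coef_integral lam sigma omega p q a =
  \int[omega]_x (\esum_(Q in range e) coef_term sigma omega lam p a x Q) `^ th.
Proof. by rewrite -QE. Qed.

Let Q0_level : exists n, Q0 \in first_values e n.
Proof.
have : range e Q0 by rewrite -QE.
by case=> i _ <-; exists i.+1; apply/mem_first_values; exists i.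
Qed.

Lemma coef_integral_lower_bound (a : set 'rV[R]_d -> R) :
  (coef_value sigma omega lam p a Q0 `^ th * fine (omega Q0))%:E <=
  coef_integral lam sigma omega p q a.
Proof.
have [n Qn] := Q0_level.
apply: (le_trans (@coef_lower_bound _ (borel_space R d) R e sigma omega lam p q
  q0 q1 p1 mQe sQe wQe n a Q0 Qn)).
rewrite coefE (@integral_esum_coef _ (borel_space R d) R e sigma omega lam p q q0 q1 p1 mQe a).
by apply: ereal_sup_ubound; exists n.
Qed.

Lemma coef_value_gt0 (a : set 'rV[R]_d -> R) : (0 < a Q0)%R ->
  (0 < coef_value sigma omega lam p a Q0)%R.
Proof.
move=> a0; have /andP[s0 sy] := sQ QQ0; have /andP[w0 wy] := wQ QQ0.
by rewrite !mulr_gt0 ?powR_gt0 ?lamP// divr_gt0// fine_gt0// ?s0 ?w0.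
Qed.

Lemma coef_integral_gt0 (a : set 'rV[R]_d -> R) : (0 < a Q0)%R ->
  0 < coef_integral lam sigma omega p q a.
Proof.
move=> a0; apply: lt_le_trans (coef_integral_lower_bound a).
rewrite lte_fin mulr_gt0 ?powR_gt0 ?coef_value_gt0//.
by have /andP[w0 wy] := wQ QQ0; rewrite fine_gt0// w0.
Qed.

(** If one factor of the bound is infinite then so is the bound, because the other factor
    is positive as soon as there is a charged cube. *)
Lemma opnorm_le_coef_bound a : (forall Q, QQ Q -> 0 < a Q)%R ->
  opnorm <= (embedding_cst p `^ p^-1)%:E * coef_bound lam sigma omega p q a.
Proof.
move=> a0; have cp0 := embedding_cst_gt0 p1.
have cpp0 : (0 < embedding_cst p `^ p^-1)%R by rewrite powR_gt0.
have B0 := coef_integral_gt0 (a0 _ QQ0).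
have A0 := carleson_const_gt0 QQ0 a0.
have Bs0 := poweR_gt0 ((p - q) / (p * q)) B0.
have As0 := poweR_gt0 p^-1 A0.
have pV0 : (0 < p^-1)%R by rewrite invr_gt0.
have [Ay|AN] := eqVneq (carleson_const lam sigma omega a) +oo.
  rewrite /coef_bound Ay poweRyr ?gt_eqF// gt0_mulye// gt0_muley ?leey//.
have [By|BN] := eqVneq (coef_integral lam sigma omega p q a) +oo.
  rewrite /coef_bound By poweRyr; last first.
    by rewrite gt_eqF// divr_gt0// mulr_gt0.
  by rewrite gt0_muley// gt0_muley ?leey.
have Af : (fine (carleson_const lam sigma omega a))%:E = carleson_const lam sigma omega a.
  by rewrite fineK// ge0_fin_numE ?carleson_const_ge0// lt_neqAle AN leey.
apply: ereal_inf_lbound; split.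
  by rewrite mule_ge0 ?coef_bound_ge0// lee_fin ltW.
move=> f fL f0; have [mf fp] := (ge0_LfunP sigma p0 f0).1 fL.
rewrite ge0_Lnorm; last by move=> x; exact: dyadic_op_ge0.
rewrite ge0_Lnorm_EFin//.
under eq_integral do rewrite opE.
have fA0 : (0 < fine (carleson_const lam sigma omega a))%R by rewrite -lte_fin Af.
have ca Q : range e Q ->
    \esum_(S in range e `&` [set S | S `<=` Q]) (((a S)^-1)%:E * sigma S) <=
    (fine (carleson_const lam sigma omega a))%:E * sigma Q.
  by rewrite Af -QE => QQQ; exact: carleson_const_bound.
have a0e Q : range e Q -> (0 < a Q)%R by rewrite -QE; exact: a0.
have := @countable_sufficiency _ (borel_space R d) R e sigma omega lam p q q0 q1 p1
  mQe lamQe sQe wQe lamPe _ a f fA0 a0e ca mf f0 fp.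
rewrite -(coefE a); set I := \int[omega]_x (\esum_(Q in range e) op_term sigma lam f x Q) `^ q.
set F := \int[sigma]_x (f x `^ p)%:E.
have F0 : 0 <= F by apply: integral_ge0 => x _; rewrite lee_fin powR_ge0.
have I0 : 0 <= I by apply: integral_ge0 => x _; exact: poweR_ge0.
have qV0 : (0 <= q^-1)%R by rewrite invr_ge0 ltW.
move=> /(le_poweR qV0 I0) /le_trans; apply.
have AC0 : 0 <= (fine (carleson_const lam sigma omega a) * embedding_cst p)%:E.
  by rewrite lee_fin mulr_ge0// ltW.
rewrite poweRM ?poweR_ge0// -!poweRrM.
have -> : (q / p * q^-1 = p^-1)%R by field; rewrite !gt_eqF.
have -> : ((p - q) / p * q^-1 = (p - q) / (p * q))%R by field; rewrite !gt_eqF.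
rewrite poweRM// EFinM poweRM ?lee_fin ?(ltW fA0) ?(ltW cp0)// Af poweR_EFin /coef_bound.
rewrite le_eqVlt; apply/orP; left; apply/eqP.
by rewrite -!muleA muleCA; congr (_ * (_ * _)); rewrite muleC.
Qed.

(** Every real number above the operator norm is an admissible constant; raised to the
    power q, the norm inequality takes the form that the countable estimates use. *)
Lemma opnorm_lt_bound (N : R) (f : borel_space R d -> R) : (0 < N)%R -> opnorm < N%:E ->
  measurable_fun setT f -> (forall x, 0 <= f x)%R ->
  \int[sigma]_x (f x `^ p)%:E < +oo ->
  \int[omega]_x (\esum_(Q in range e) op_term sigma lam f x Q) `^ q <=
  (N `^ q)%:E * (\int[sigma]_x (f x `^ p)%:E) `^ (q / p).
Proof.
move=> N0 /ereal_inf_lt[C [C0 CP] CN] mf f0 fp.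
have := CP f ((ge0_LfunP sigma p0 f0).2 (conj mf fp)) f0.
rewrite ge0_Lnorm; last by move=> x; exact: dyadic_op_ge0.
rewrite ge0_Lnorm_EFin//; under eq_integral do rewrite opE.
set I := \int[omega]_x _ ; set F := \int[sigma]_x _.
have F0 : 0 <= F by apply: integral_ge0 => x _; rewrite lee_fin powR_ge0.
have I0 : 0 <= I by apply: integral_ge0 => x _; exact: poweR_ge0.
move=> /(le_poweR (ltW q0) (poweR_ge0 _ _)).
rewrite poweRM ?poweR_ge0// -!poweRrM mulVf ?gt_eqF// poweRe1// (mulrC (p^-1)%R).
move=> /le_trans; apply; apply: lee_wpmul2r; first exact: poweR_ge0.
by rewrite -poweR_EFin; apply: le_poweR; [exact: ltW|exact: C0|exact: ltW].
Qed.

Local Notation nc := (limit_cst p q).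
Local Notation t := (p * q / (p - q))%R.

Lemma necessity_coefficients (N : R) : (0 < N)%R -> opnorm < N%:E ->
  exists a : set 'rV[R]_d -> R, [/\ forall Q, QQ Q -> (1 <= a Q)%R,
    carleson_const lam sigma omega a <= 2%:E &
    coef_integral lam sigma omega p q a <= (nc * N `^ t)%:E].
Proof.
move=> N0 oN; have normN := fun f => @opnorm_lt_bound N f N0 oN.
have [a [a1 ca Ba]] := @countable_necessity _ (borel_space R d) R e sigma omega lam
  p q q0 q1 p1 mQe lamQe sQe wQe lamPe N N0 normN.
exists a; split; first by rewrite QE.
- apply: ge_ereal_sup => _ [->|[Q QQQ <-]]; first by rewrite lee_fin.
  have := ca Q; rewrite -QE => /(_ QQQ); have /andP[s0 sy] := sQ QQQ.
  have s0' : (0 < fine (sigma Q))%R by rewrite fine_gt0// s0.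
  have sE : sigma Q = (fine (sigma Q))%:E by rewrite fineK// ge0_fin_numE// ltW.
  by rewrite [in (sigma Q)^-1]sE inver (gt_eqF s0') lee_pdivrMl// muleC -sE.
- by rewrite coefE /limit_cst -[(_ * necessity_cst p q * _)%R]mulrA.
Qed.

(** Otherwise every N > 0 is admissible, and as a >= 1 the integral of the coefficients is
    at least a constant independent of N, while it is at most a multiple of a positive power
    of N. *)
Lemma opnorm_gt0 : 0 < opnorm.
Proof.
rewrite lt_neqAle dyadic_op_norm_ge0 andbT eq_sym; apply/negP => /eqP on0.
have nc0 : (0 < nc)%R by exact: limit_cst_gt0.
have t0 : (0 < t)%R by rewrite divr_gt0// mulr_gt0.
have one0 : (0 < (fun=> 1%R : R) Q0)%R by [].
set c0 := (coef_value sigma omega lam p (fun=> 1%R) Q0 `^ th * fine (omega Q0))%R.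
have c00 : (0 < c0)%R.
  rewrite mulr_gt0 ?powR_gt0 ?coef_value_gt0//.
  by have /andP[w0 wy] := wQ QQ0; rewrite fine_gt0// w0.
(* The value for which nc * N `^ t is half of the lower bound c0. *)
pose N := ((c0 / (2 * nc)) `^ t^-1)%R.
have N0 : (0 < N)%R by rewrite powR_gt0// divr_gt0// mulr_gt0.
have [|a [a1 _ Ba]] := necessity_coefficients N0; first by rewrite on0 lte_fin.
have := le_trans (coef_integral_lower_bound a) Ba.
rewrite lee_fin /N -powRrM mulVf ?gt_eqF// powRr1; last first.
  by rewrite divr_ge0 ?(ltW c00)// ltW// mulr_gt0.
have -> : (nc * (c0 / (2 * nc)) = c0 / 2)%R.
  by field; rewrite gt_eqF.
apply/negP; rewrite -ltNge; apply: (@lt_le_trans _ _ c0); first lra.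
rewrite /c0; apply: ler_wpM2r; first exact: fine_ge0.
apply: ge0_ler_powR; rewrite ?nnegrE ?coef_value_ge0 ?(ltW th0)//.
rewrite /coef_value; apply: ler_wpM2l; first by rewrite mulr_ge0 ?powR_ge0.
apply: ge0_ler_powR; rewrite ?nnegrE//.
- by rewrite subr_ge0 ltW// conj_exp_gt1.
- exact: le_trans (a1 _ QQ0).
- exact: a1.
Qed.

(** As opnorm is positive and finite, N := 2 opnorm exceeds the infimum that defines it and
    is therefore an admissible constant. *)
Lemma coef_bound_le_opnorm : opnorm < +oo ->
  exists a : set 'rV[R]_d -> R, (forall Q, QQ Q -> 0 < a Q)%R /\
  coef_bound lam sigma omega p q a <=
    (reverse_cst p q)%:E * opnorm.
Proof.
move=> ony; have on0 := opnorm_gt0.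
have onE : opnorm = (fine opnorm)%:E by rewrite fineK// ge0_fin_numE// ltW.
set N := fine opnorm in onE.
have N0 : (0 < N)%R by rewrite -lte_fin -onE.
have N20 : (0 < 2 * N)%R by rewrite mulr_gt0.
have [|a [a1 ca Ba]] := necessity_coefficients N20; first by rewrite onE lte_fin; lra.
have nc0 : (0 <= nc)%R by rewrite ltW// limit_cst_gt0.
exists a; split=> [Q /a1|]; first exact: lt_le_trans.
rewrite onE; apply: (@le_trans _ _ (2%:E `^ p^-1 * (nc * (2 * N) `^ t)%:E `^ ((p - q) / (p * q)))).
  apply: lee_pmul; rewrite ?poweR_ge0//.
    apply: le_poweR ca; first by rewrite invr_ge0 ltW.
    exact: carleson_const_ge0.
  apply: le_poweR Ba; last exact: coef_integral_ge0.
  by rewrite divr_ge0 ?(ltW pq0)// mulr_ge0 ?(ltW p0) ?(ltW q0).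
rewrite !poweR_EFin -!EFinM lee_fin powRM ?powR_ge0// -powRrM.
have -> : (t * ((p - q) / (p * q)) = 1)%R by field; rewrite !gt_eqF.
rewrite powRr1 ?(ltW N20)// /reverse_cst; lra.
Qed.

End nonempty.
End charged.

Theorem theorem1p1 (R : realType) (p q : R)
    (hq0 : (0 < q)%R) (hq1 : (q < 1)%R) (hp : (1 < p)%R) :
  (exists C : R, (0 < C)%R /\
    forall (d : nat)
      (sigma omega : {measure set (borel_space R d) -> \bar R})
      (lambda : set 'rV[R]_d -> R),
      locally_finite sigma -> locally_finite omega ->
      (forall Q, dyadic Q -> (0 <= lambda Q)%R) ->
      forall a : set 'rV[R]_d -> R,
        (forall Q, charged_cubes lambda sigma omega Q -> (0 < a Q)%R) ->
        dyadic_op_norm lambda sigma omega p q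
          <= C%:E * coef_bound lambda sigma omega p q a)
  /\
  (exists C' : R, (0 < C')%R /\
    forall (d : nat)
      (sigma omega : {measure set (borel_space R d) -> \bar R})
      (lambda : set 'rV[R]_d -> R),
      locally_finite sigma -> locally_finite omega ->
      (forall Q, dyadic Q -> (0 <= lambda Q)%R) ->
      exists a : set 'rV[R]_d -> R,
        (forall Q, charged_cubes lambda sigma omega Q -> (0 < a Q)%R) /\
        coef_bound lambda sigma omega p q a
          <= C'%:E * dyadic_op_norm lambda sigma omega p q).
Proof.
have dich (d : nat) (sigma omega : {measure set (borel_space R d) -> \bar R})
    (lambda : set 'rV[R]_d -> R) :
    charged_cubes lambda sigma omega = set0 \/
    exists (e : nat -> set 'rV[R]_d) (Q0 : set 'rV[R]_d),
      charged_cubes lambda sigma omega = range e /\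
      charged_cubes lambda sigma omega Q0.
  have [[Q0 QQ0]|QQ0] := pselect (charged_cubes lambda sigma omega !=set0).
    right; have dQ : charged_cubes lambda sigma omega `<=` @dyadic R d by move=> Q [].
    have [e QE] := dyadic_enumeration dQ (ex_intro _ _ QQ0).
    by exists e, Q0.
  by left; apply/seteqP; split=> // Q QQQ; apply: QQ0; exists Q.
have c0 := embedding_cst_gt0 hp.
split.
  exists (embedding_cst p `^ p^-1)%R; split; first by rewrite powR_gt0.
  move=> d sigma omega lambda lfs lfw lam0 a a0.
  have [QQ0|[e [Q0 [QE QQ0]]]] := dich d sigma omega lambda.
    by rewrite dyadic_op_norm0// mule_ge0 ?coef_bound_ge0// lee_fin powR_ge0.
  exact: (opnorm_le_coef_bound lfs lfw hq0 hq1 hp QE QQ0).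
exists (reverse_cst p q); split; first exact: reverse_cst_gt0.
  move=> d sigma omega lambda lfs lfw lam0.
  have [QQ0|[e [Q0 [QE QQ0]]]] := dich d sigma omega lambda.
    exists (fun=> 1%R); split; first by rewrite QQ0.
    by rewrite dyadic_op_norm0// coef_bound0// mule0.
  have [ony|onN] := boolP (dyadic_op_norm lambda sigma omega p q < +oo).
    exact: (coef_bound_le_opnorm lfs lfw hq0 hq1 hp QE QQ0 ony).
  exists (fun=> 1%R); split=> //; move: onN; rewrite -leNgt leye_eq => /eqP ->.
  by rewrite gt0_muley ?leey// lte_fin; exact: reverse_cst_gt0.
Qed.
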